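(* Let $q\in\left(\frac13,1\right]$, and let the initial labels $(\rho(x))_{x\in\mathbb{Z}^2}$ be drawn independently and uniformly from $\{\mathcal{H},\mathcal{V}\}$. Then the $\mathcal{H}$–$\mathcal{V}$ walk with parameter $q$, with a single walker and with initial labels $\rho$, is recurrent almost surely; that is, for almost every $\rho$, the walk with initial labels $\rho$ visits every vertex of $\mathbb{Z}^2$ infinitely many times with probability $1$.
   Context: $\mathcal{H}$–$\mathcal{V}$ walk on $\mathbb{Z}^2$ with parameter $q$ and a single walker: each vertex of $\mathbb{Z}^2$ carries a label $\mathcal{H}$ or $\mathcal{V}$ (initially given by $\rho$), and the walker starts at the origin $(0,0)$. At each discrete time step, the walker first changes the label of its current location $x$ ($\mathcal{H}$ to $\mathcal{V}$, or $\mathcal{V}$ to $\mathcal{H}$) with probability $q$ and keeps it with probability $1-q$, independently of the past. Then, if the new label at $x$ is $\mathcal{H}$ it moves to $x+(1,0)$ or $x-(1,0)$ with probability $\frac12$ each, and if the new label is $\mathcal{V}$ it moves to $x+(0,1)$ or $x-(0,1)$ with probability $\frac12$ each, independently of the past. The randomness of the walk is independent of the choice of the initial labels. *)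

(* Defs.v *)
From mathcomp Require Import all_boot all_order all_algebra.
From mathcomp Require Import all_classical all_reals all_analysis.

Set Implicit Arguments.
Unset Strict Implicit.
Unset Printing Implicit Defensive.

Import Order.TTheory GRing.Theory Num.Theory.
Local Open Scope classical_set_scope.
Local Open Scope ring_scope.

(* Mutual independence of a family of random variables, given as the product
   rule over finite subfamilies: s is duplicate-free, so each index is used
   at most once. *)
Definition mutually_independent (R : realType) (d d' : measure_display)
    (T : measurableType d) (T' : measurableType d') (P : probability T R)
    (I : choiceType) (X : I -> {RV P >-> T'}) : Prop :=
  forall (s : seq I) (A : I -> set T'), uniq s ->
    (forall i, measurable (A i)) ->
    P (\bigcap_(i in [set` s]) (X i @^-1` A i)) =
      (\prod_(i <- s) P (X i @^-1` A i))%E.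

(* X takes the value true with probability p (and false with probability
   1 - p). *)
Definition bernoulli_rv (R : realType) (d : measure_display)
    (T : measurableType d) (P : probability T R) (p : R)
    (X : {RV P >-> bool}) : Prop :=
  P (X @^-1` [set true]) = p%:E.

Definition vertex := (int * int)%type.

(* true is the label H, false the label V. *)
Definition labelling := vertex -> bool.

Record state := State { position : vertex; labels : labelling }.

(* The label at the current location is flipped iff flip holds; the walker then
   moves along the axis given by the new label, forward iff forth holds. *)
Definition hv_step (flip forth : bool) (st : state) : state :=
  let x := position st in
  let l := labels st x (+) flip in
  let e : int := if forth then 1 else -1 in
  State (if l then (x.1 + e, x.2) else (x.1, x.2 + e))
        (fun y => if y == x then l else labels st y).

Fixpoint hv_walk (rho : labelling) (flip forth : nat -> bool) (n : nat)
    : state :=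
  if n is m.+1 then hv_step (flip m) (forth m) (hv_walk rho flip forth m)
  else State (0, 0) rho.

Definition visits_all_infinitely_often (rho : labelling)
    (flip forth : nat -> bool) : Prop :=
  forall x : vertex,
    infinite_set [set n | position (hv_walk rho flip forth n) = x].

(* The random inputs of the walk as a single family, so that independence
   holds between flips and directions as well as among each of them. *)
Definition walk_inputs (R : realType) (d : measure_display)
    (T : measurableType d) (P : probability T R)
    (flip forth : nat -> {RV P >-> bool}) (i : nat + nat) : {RV P >-> bool} :=
  match i with inl n => flip n | inr n => forth n end.

(* The randomness of the H-V walk with parameter q, realised on (T, P):
   flip n decides whether the label changes at step n, forth n the sense of
   the move. *)
Definition hv_randomness (R : realType) (q : R) (d : measure_display)
    (T : measurableType d) (P : probability T R)
    (flip forth : nat -> {RV P >-> bool}) : Prop :=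
  [/\ mutually_independent (walk_inputs flip forth),
      forall n, bernoulli_rv q (flip n) &
      forall n, bernoulli_rv 2^-1 (forth n)].

Definition iid_uniform_labels (R : realType) (d : measure_display)
    (T : measurableType d) (P : probability T R)
    (rho : vertex -> {RV P >-> bool}) : Prop :=
  mutually_independent rho /\ forall x, bernoulli_rv 2^-1 (rho x).

(* Main.v *)
Require Import Defs.
From mathcomp Require Import all_boot all_order all_algebra.
From mathcomp Require Import all_classical all_reals all_analysis.
From mathcomp Require Import zify ring lra.
Import Order.TTheory GRing.Theory Num.Theory.
Local Open Scope classical_set_scope.
Local Open Scope ring_scope.

(** Translate the target vertex to the origin. The heart of the proof is a
    hitting bound: from every state whose labels are typical far away, the walk
    reaches the origin with probability at least some d > 0 that depends only
    on q ([hit_bound_all]). A step changes one label, so typical labels stay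
    typical, the bound can be applied again and again, and the probability of
    avoiding the origin for n steps tends to 0 ([avoid_small]). Hence no vertex
    has a last visit.

    Let f(x) = ln (|x|^2 - 1/2), with f(0) negative enough: f is superharmonic
    off the origin for simple random walk ([potential_superharmonic]). The mean
    change of f in a step of the H-V walk differs from that for simple random
    walk by a multiple of the shear D(x), half the excess of the horizontal over
    the vertical second difference of f, with a sign given by the label at x. As
    the label flips with probability q, this bias is paid for by a weight on the
    labels: with s = 1 at H and s = -1 at V, and c = 1/(2q) - 1,
      f(X) + (c/2) * sum of D(x) s(x) over a box of radius n
    is a supermartingale until the walk reaches the origin or leaves the box
    ([energy_super]). Outside the box f is at least 2 ln n - O(1), and summation
    by parts bounds the sum of |D| over the box by 8 ln n + O(1)
    ([sum_shear_le]). So the labels contribute at most 4 |c| ln n + O(1) in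
    absolute value, and o(ln n) at the start if they are typical; optional
    stopping shows that the walk leaves the box before reaching the origin with
    probability at most 2 |c| + o(1). This is below 1 exactly when |c| < 1/2,
    that is for 1/3 < q < 1 ([hit_bound_lt1]).

    For q = 1 we have c = -1/2 and the two logarithms balance. The worst case is
    then a walk that stops with the label H at nearly all vertices where D > 0.
    It is excluded by a surgery on paths. Take a square block of four vertices
    in a cone around the vertical axis, where D > 0. A path that leaves the block
    for the last time with all four labels H can be lengthened at that moment
    by a detour of six steps inside the block, after which it continues as
    before but leaves two labels V behind ([detour]). The detour costs a factor
    2^-6, and it can be read off from the new path; so a block that is not all
    H at the start is not all H at the end with probability at least 1/65
    ([misaligned_end]). Summed over the cone, this improves the label bound by a
    fixed multiple of ln n ([hit_bound_eq1]).

    That almost all initial labels are typical is a variance computation: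
    the sum of D s over the box has variance O(ln n) ([ae_balanced]). *)

Set Implicit Arguments.
Unset Strict Implicit.
Unset Printing Implicit Defensive.

(** * A superharmonic logarithm *)

Section Potential.
Variable R : realType.
Implicit Types (t : R) (x y : int) (v : vertex).

(** With the shift by 1/2, superharmonicity away from the neighbours of the origin
    comes down to a perfect square being nonnegative. The value at 0 replaces the
    undefined logarithm; it is the largest one for which the function remains
    superharmonic at the four neighbours of the origin. *)
Definition radial_log t : R := if t < 1 then ln (126^-1) else ln (t - 2^-1).

Definition sqnorm v : R := v.1%:~R ^+ 2 + v.2%:~R ^+ 2.

Definition potential v : R := radial_log (sqnorm v).

Definition hdiff v : R :=
  2^-1 * (potential (v.1 + 1, v.2) + potential (v.1 - 1, v.2)) - potential v.
Definition vdiff v : R :=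
  2^-1 * (potential (v.1, v.2 + 1) + potential (v.1, v.2 - 1)) - potential v.
Definition shear v : R := hdiff v - vdiff v.

Lemma sqnormE v : sqnorm v = (absz v.1 ^ 2 + absz v.2 ^ 2)%N%:R.
Proof.
rewrite /sqnorm natrD !natrX.
have e x : (x%:~R : R) ^+ 2 = (absz x)%:R ^+ 2.
  have -> : ((absz x)%:R : R) = `|x|%:~R by rewrite -abszE.
  by rewrite intr_norm real_normK ?num_real.
by rewrite !e.
Qed.

Lemma radial_log_nat n :
  radial_log n%:R = if n == 0%N then ln (126^-1) else ln (n%:R - 2^-1) :> R.
Proof.
by rewrite /radial_log (ltr_nat R n 1) ltnS leqn0.
Qed.

Lemma radial_log_ge1 t : 1 <= t -> radial_log t = ln (t - 2^-1).
Proof. by move=> t1; rewrite /radial_log ifF //; apply/negbTE; rewrite -leNgt; lra. Qed.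

Lemma sqnorm_ge1 v : v != (0, 0) -> 1 <= sqnorm v.
Proof.
move=> v0; rewrite sqnormE (ler_nat _ 1).
case: v v0 => x y; rewrite xpair_eqE negb_and /= => h.
have : (0 < absz x \/ 0 < absz y)%N by lia.
by rewrite -!mulnn; nia.
Qed.

Lemma sqnorm_ge0 v : 0 <= sqnorm v.
Proof. by rewrite addr_ge0 // sqr_ge0. Qed.

(** The case of equality that fixes the value at the origin: the arguments are
    the squared distances 0, 4, 2, 2 of the neighbours of (1, 0). *)
Lemma potential_axis_neighbour :
  ln (126^-1) + ln (4 - 2^-1) + ln (2 - 2^-1) + ln (2 - 2^-1) = 4 * ln (1 - 2^-1) :> R.
Proof.
rewrite -!lnM ?posrE; try lra.
have -> : 4 * ln (1 - 2^-1) = ln ((1 - 2^-1) ^+ 4) :> R.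
  by rewrite lnXn ?mulr_natl //; lra.
by congr ln; lra.
Qed.

(** With (a, b) = v and r = a^2 + b^2 - 1/2, the product of the four neighbouring
    values of exp f is ((r + 1)^2 - 4 a^2) ((r + 1)^2 - 4 b^2), which is smaller
    than r^4 by 4 (a^2 - b^2)^2. *)
Lemma potential_superharmonic v : v != (0, 0) -> hdiff v + vdiff v <= 0.
Proof.
move=> v0; rewrite /hdiff /vdiff.
suff : potential (v.1 + 1, v.2) + potential (v.1 - 1, v.2)
     + potential (v.1, v.2 + 1) + potential (v.1, v.2 - 1) <= 4 * potential v by lra.
(* At a neighbour of the origin the special value there is used. *)
have [n1|n1] := eqVneq (absz v.1 ^ 2 + absz v.2 ^ 2)%N 1%N.
  have : v = (1, 0) \/ v = (-1, 0) \/ v = (0, 1) \/ v = (0, -1).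
    case: v v0 n1 => x y _ /=; rewrite -!mulnn => n1.
    have [[hx hy]|[hx hy]] : (absz x = 0 /\ absz y = 1)%N \/ (absz x = 1 /\ absz y = 0)%N.
    - by move: (absz x) (absz y) n1 => i j; nia.
    - have -> : x = 0 by lia.
      have h : y = 1 \/ y = -1 by lia.
      by case: h => ->; auto.
    - have -> : y = 0 by lia.
      have h : x = 1 \/ x = -1 by lia.
      by case: h => ->; auto.
  have l := potential_axis_neighbour.
  by case=> [->|[->|[->|->]]]; rewrite /potential !sqnormE /= !radial_log_nat /=; lra.
have N2 : 2 <= sqnorm v.
  rewrite sqnormE (ler_nat _ 2).
  have := sqnorm_ge1 v0; rewrite sqnormE (ler_nat _ 1).
  by move: (_ + _)%N n1 => k; lia.
have ne w : (absz (w.1 - v.1) + absz (w.2 - v.2) <= 1)%N -> 1 <= sqnorm w.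
  move=> h; apply: sqnorm_ge1; apply/eqP => w0; move: h; rewrite w0 /=.
  have : (2 <= absz v.1 ^ 2 + absz v.2 ^ 2)%N by rewrite -(ler_nat R) -sqnormE.
  by rewrite -!mulnn; nia.
have [a ea] : exists a : R, a = v.1%:~R by exists (v.1%:~R).
have [b eb] : exists a : R, a = v.2%:~R by exists (v.2%:~R).
have := ne (v.1 + 1, v.2); have := ne (v.1 - 1, v.2).
have := ne (v.1, v.2 + 1); have := ne (v.1, v.2 - 1).
move: N2; rewrite /potential /sqnorm /= !(intrD, mulrNz, mulr1z) -ea -eb.
move=> N2 /(_ ltac:(lia)) h1 /(_ ltac:(lia)) h2 /(_ ltac:(lia)) h3 /(_ ltac:(lia)) h4.
rewrite !radial_log_ge1 //; last lra.
rewrite -!lnM ?posrE ?mulr_gt0 //; try lra.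
have -> : 4 * ln (a ^+ 2 + b ^+ 2 - 2^-1) = ln ((a ^+ 2 + b ^+ 2 - 2^-1) ^+ 4) :> R.
  by rewrite lnXn ?mulr_natl //; lra.
rewrite ler_ln ?posrE ?mulr_gt0 ?exprn_gt0 //; try lra.
rewrite -subr_ge0.
set e := (e in 0 <= e).
have -> : e = 4 * (a ^+ 2 - b ^+ 2) ^+ 2.
  rewrite /e.
 by field.
by rewrite mulr_ge0 ?sqr_ge0.
Qed.

End Potential.

(** * Boxes and summation by parts *)

Fixpoint int_range n : seq int :=
  if n is m.+1 then n%:Z :: - n%:Z :: int_range m else [:: 0].

Definition box n : seq vertex := [seq (x, y) | x <- int_range n, y <- int_range n].

Lemma mem_int_range n x : (x \in int_range n) = (absz x <= n)%N.
Proof.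
by elim: n => [|n IH] /=; rewrite !inE ?IH; lia.
Qed.

Lemma int_range_uniq n : uniq (int_range n).
Proof.
by elim: n => [//|n IH] /=; rewrite IH !inE !mem_int_range; lia.
Qed.

Lemma mem_box n v : (v \in box n) = (absz v.1 <= n)%N && (absz v.2 <= n)%N.
Proof.
case: v => x y; rewrite -!mem_int_range; apply/allpairsP/andP => [[p [h1 h2 ->]]|[h1 h2]] //.
by exists (x, y).
Qed.

Lemma box_uniq n : uniq (box n).
Proof. by apply: allpairs_uniq; rewrite ?int_range_uniq // => -[a b] [c d]. Qed.

Section PotentialSums.
Variable R : realType.
Local Notation pot := (@potential R).

Lemma sum_int_range_le n (F : int -> R) : (forall x, 0 <= F x) ->
  (forall x, F (- x) = F x) ->
  \sum_(x <- int_range n) F x <= 2 * \sum_(i < n.+1) F i%:Z.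
Proof.
move=> F0 FN; elim: n => [|n IH] /=; first by rewrite big_seq1 big_ord1 /=; have := F0 0; lra.
by rewrite !big_cons big_ord_recr /= FN; lra.
Qed.

Lemma sum_box n (F : vertex -> R) :
  \sum_(v <- box n) F v = \sum_(x <- int_range n) \sum_(y <- int_range n) F (x, y).
Proof. exact: big_allpairs. Qed.

Lemma potNl x y : pot (- x, y) = pot (x, y).
Proof. by rewrite /potential !sqnormE /= abszN. Qed.
Lemma potC x y : pot (y, x) = pot (x, y).
Proof. by rewrite /potential /sqnorm addrC. Qed.

Lemma shearNl x y : shear R (- x, y) = shear R (x, y).
Proof.
rewrite /shear /hdiff /vdiff /= -!(potNl (- x)) -(potNl (- x + 1)) -(potNl (- x - 1)).
by rewrite !opprD !opprK [pot (x - 1, y) + _]addrC.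
Qed.
Lemma shearC x y : shear R (y, x) = - shear R (x, y).
Proof.
rewrite /shear /hdiff /vdiff /=.
by rewrite !(potC (y + 1) x) !(potC (y - 1) x)
  !(potC y (x + 1)) !(potC y (x - 1)) !(potC y x); lra.
Qed.
Lemma shearNr x y : shear R (x, - y) = shear R (x, y).
Proof. by rewrite shearC shearNl shearC opprK. Qed.
Lemma shear_diag x : shear R (x, x) = 0.
Proof. by have /eqP := shearC x x; rewrite -addr_eq0 -mulr2n mulrn_eq0 => /eqP. Qed.

Lemma pot_nat (m n : nat) : (0 < m + n)%N ->
  pot (m%:Z, n%:Z) = ln (m%:R ^+ 2 + n%:R ^+ 2 - 2^-1).
Proof.
move=> h; rewrite /potential sqnormE /= radial_log_nat natrD !natrX ifF //.
by rewrite addn_eq0 !expn_eq0 /=; lia.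
Qed.

Lemma pot_ge v : ln (126^-1) <= pot v.
Proof.
rewrite /potential sqnormE radial_log_nat; case: eqP => // h.
rewrite ler_ln ?posrE; try lra;
  have : (1 : R) <= ((`|v.1| ^ 2 + `|v.2| ^ 2)%N)%:R by rewrite (ler_nat _ 1); lia.
all: lra.
Qed.

Lemma pot_out n v : v \notin box n -> 2 * ln n.+1%:R - ln 2 <= pot v.
Proof.
rewrite mem_box negb_and -!ltnNge => h.
have h' : (n.+1 ^ 2 <= absz v.1 ^ 2 + absz v.2 ^ 2)%N by rewrite -!mulnn; case/orP: h; nia.
rewrite /potential sqnormE radial_log_nat ifF; last first.
  by apply/negbTE; move: h'; rewrite -!mulnn; nia.
have : (n.+1 ^ 2)%N%:R <= ((`|v.1| ^ 2 + `|v.2| ^ 2)%N)%:R :> R by rewrite ler_nat.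
move: (_ + _)%N => N; rewrite natrX.
have : 1 <= n.+1%:R :> R by rewrite (ler_nat _ 1).
move: (n.+1%:R) (N%:R) => a b a1 ab.
have b1 : 1 <= b by nra.
have -> : 2 * ln a = ln (a ^+ 2) by rewrite lnXn ?mulr_natl //; lra.
rewrite -ln_div ?posrE; try nra.
by rewrite ler_ln ?posrE; nra.
Qed.

Lemma sum_hdiff (n : int) k :
  \sum_(i < k) hdiff R (i%:Z, n) =
  2^-1 * ((pot (k%:Z, n) - pot (k%:Z - 1, n)) + (pot (1, n) - pot (0, n))).
Proof.
elim: k => [|k IH]; first by rewrite big_ord0 sub0r (potNl 1); lra.
rewrite big_ord_recr /= IH /hdiff /=.
have -> : k.+1%:Z = k%:Z + 1 by lia.
by rewrite addrK; lra.
Qed.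

(** The boundary term at height n of the summation by parts of the vertical
    second differences. *)
Definition outflow n : R := 2^-1 * \sum_(i < n.+1) (pot (i%:Z, n%:Z + 1) - pot (i%:Z, n%:Z)).

Lemma sum_vdiff n :
  \sum_(i < n.+2) vdiff R (i%:Z, n.+1%:Z) =
  outflow n.+1 - outflow n - 2^-1 * (pot (n.+1%:Z, n.+1%:Z) - pot (n.+1%:Z, n%:Z)).
Proof.
rewrite /outflow -[in X in _ = _ - X - _](addrK
  (pot (n.+1%:Z, n.+1%:Z) - pot (n.+1%:Z, n%:Z)) (\sum_(i < n.+1) _)).
rewrite (_ : \sum_(i < n.+1) (pot (i%:Z, n%:Z + 1) - pot (i%:Z, n%:Z)) + _ =
  \sum_(i < n.+2) (pot (i%:Z, n.+1%:Z) - pot (i%:Z, n%:Z))); last first.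
  rewrite [RHS]big_ord_recr /=; congr (_ + _); apply: eq_bigr => i _.
  by rewrite (_ : n%:Z + 1 = n.+1%:Z) //; lia.
rewrite (_ : \sum_(i < n.+2) vdiff R _ = 2^-1 *
  (\sum_(i < n.+2) (pot (i%:Z, n.+1%:Z + 1) - pot (i%:Z, n.+1%:Z))
   - \sum_(i < n.+2) (pot (i%:Z, n.+1%:Z) - pot (i%:Z, n%:Z)))); first by lra.
rewrite -sumrB mulr_sumr; apply: eq_bigr => i _; rewrite /vdiff /=.
by rewrite (_ : n.+1%:Z - 1 = n%:Z); [lra|lia].
Qed.

Lemma outflow_ge0 n : (0 < n)%N -> 0 <= outflow n.
Proof.
move=> n0; rewrite mulr_ge0 ?sumr_ge0 // => i _.
rewrite (_ : n%:Z + 1 = n.+1%:Z); last lia.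
rewrite !pot_nat; try lia.
have n1 : 1 <= n%:R :> R by rewrite (ler_nat _ 1).
rewrite subr_ge0 ler_ln ?posrE -?(natr1 n); nra.
Qed.

(** Rows of horizontal and columns of vertical second differences telescope, so
    the sum over a row of the octant leaves first differences of f at the
    diagonal, the axis and the boundary. At the diagonal these are logarithms
    of (2n + 3) / (2n + 1), the increments of ln (2n + 1). *)
Lemma shell_sum n : (0 < n)%N ->
  \sum_(i < n.+1) shear R (i%:Z, n.+1%:Z) + outflow n.+1 - outflow n
  <= ln (2 * n%:R + 3) - ln (2 * n%:R + 1) + 2^-1 * (n%:R^-1 - n.+1%:R^-1).
Proof.
move=> n0.
have -> : \sum_(i < n.+1) shear R (i%:Z, n.+1%:Z) =
    \sum_(i < n.+2) hdiff R (i%:Z, n.+1%:Z) - \sum_(i < n.+2) vdiff R (i%:Z, n.+1%:Z).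
  by rewrite -sumrB [RHS]big_ord_recr /= -/(shear R _) shear_diag addr0.
rewrite sum_vdiff sum_hdiff.
rewrite (_ : n.+2%:Z - 1 = n.+1%:Z); last lia.
rewrite (_ : 1 = 1%:Z) // (_ : 0 = 0%:Z) // !pot_nat //.
have n1 : 1 <= n%:R :> R by rewrite (ler_nat _ 1).
rewrite -!(natr1 n.+1) -!(natr1 n).
move: (n%:R) n1 => a a1.
have la : ln ((a + 1 + 1) ^+ 2 + (a + 1) ^+ 2 - 2^-1) = ln 2^-1 + 2 * ln (2 * a + 3).
  rewrite [2 * ln _](_ : _ = ln ((2 * a + 3) ^+ 2)); last by rewrite lnXn ?mulr_natl //; lra.
  by rewrite -lnM ?posrE; [congr ln; field|lra|nra].
have lb : ln ((a + 1) ^+ 2 + (a + 1) ^+ 2 - 2^-1) = ln 2^-1 + ln (2 * a + 1) + ln (2 * a + 3).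
  by rewrite -!lnM ?posrE; [congr ln; field|lra|lra|nra|lra].
have lc : ln ((a + 1) ^+ 2 + a ^+ 2 - 2^-1) = ln 2^-1 + 2 * ln (2 * a + 1).
  rewrite [2 * ln _](_ : _ = ln ((2 * a + 1) ^+ 2)); last by rewrite lnXn ?mulr_natl //; lra.
  by rewrite -lnM ?posrE; [congr ln; field|lra|nra].
have ld : ln (1%:R ^+ 2 + (a + 1) ^+ 2 - 2^-1) -
    ln (0%:R ^+ 2 + (a + 1) ^+ 2 - 2^-1) <= a^-1 - (a + 1)^-1.
  rewrite -ln_div ?posrE; try nra.
  apply: (@le_trans _ _ (((a + 1) ^+ 2 - 2^-1)^-1)).
    rewrite (_ : _ / _ = 1 + ((a + 1) ^+ 2 - 2^-1)^-1); last by field; apply/eqP; nra.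
    by rewrite le_ln1Dx // (lt_le_trans (ltrN10 _)) // invr_ge0; nra.
  rewrite (_ : a^-1 - (a + 1)^-1 = (a * (a + 1))^-1); last by field; apply/andP; split; lra.
  by rewrite lef_pV2 ?posrE; nra.
by rewrite la lb lc; lra.
Qed.

(** Here shear = (1/2) ln (A / B) with A - B = 4 (n^2 - m^2), and ln (A / B) is at
    least (A - B) / A. *)
Lemma shear_ge (m n : nat) : (m < n)%N -> (1 < n)%N ->
  2 * (n%:R ^+ 2 - m%:R ^+ 2) / (m%:R ^+ 2 + n%:R ^+ 2 + 2^-1) ^+ 2 <= shear R (m%:Z, n%:Z).
Proof.
move=> mn n1; rewrite /shear /hdiff /vdiff /=.
rewrite (_ : m%:Z + 1 = m.+1%:Z); last lia.
rewrite (_ : n%:Z + 1 = n.+1%:Z); last lia.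
rewrite (_ : pot (m%:Z - 1, n%:Z) = pot ((absz (m%:Z - 1))%:Z, n%:Z)); last first.
  by case: m {mn} => [|m]; rewrite ?sub0r ?potNl //= ; congr (pot (_, _)); lia.
rewrite (_ : n%:Z - 1 = n.-1%:Z); last lia.
rewrite !pot_nat; try lia.
have -> : ((absz (m%:Z - 1))%:R : R) ^+ 2 = (m%:R - 1) ^+ 2.
  rewrite (_ : (absz (m%:Z - 1))%:R = `|m%:Z - 1|%:~R :> R); last by rewrite -abszE.
  by rewrite intr_norm real_normK ?num_real // intrB.
have -> : n.-1%:R = n%:R - 1 :> R by rewrite -[in RHS](prednK (ltnW n1)) -natr1 addrK.
have a0 : 0 <= m%:R :> R by [].
have ab : m%:R + 1 <= n%:R :> R by rewrite natr1 ler_nat.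
have b2 : 2 <= n%:R :> R by rewrite (ler_nat _ 2).
rewrite -(natr1 m) -(natr1 n); move: (m%:R) (n%:R) a0 ab b2 => a b a0 ab b2.
have red (p s t : R) : 2^-1 * s - p - (2^-1 * t - p) = - (2^-1 * (t - s)) by lra.
rewrite red -!lnM ?posrE; try nra.
rewrite -ln_div ?posrE; try by rewrite mulr_gt0; nra.
set B := (X in ln (X / _)); set A := (X in ln (_ / X)).
have eA : A = (a ^+ 2 + b ^+ 2 + 2^-1) ^+ 2 - 4 * a ^+ 2 by rewrite /A; field.
have eB : B = (a ^+ 2 + b ^+ 2 + 2^-1) ^+ 2 - 4 * b ^+ 2 by rewrite /B; field.
have A0 : 0 < A by rewrite /A mulr_gt0; nra.
have B0 : 0 < B by rewrite /B mulr_gt0; nra.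
set S := (_ + 2^-1) in eA eB *.
have S0 : 0 < S by rewrite /S; nra.
have h : ln (B / A) <= - ((A - B) / A).
  rewrite (_ : B / A = 1 + - ((A - B) / A)); last by field; lra.
  rewrite le_ln1Dx // ltrN2 ltr_pdivrMr //; lra.
have h2 : 4 * (b ^+ 2 - a ^+ 2) / S ^+ 2 <= (A - B) / A.
  rewrite (_ : A - B = 4 * (b ^+ 2 - a ^+ 2)); last by rewrite eA eB; ring.
  rewrite ler_wpM2l ?lef_pV2 ?posrE ?exprn_gt0 //; first by nra.
  by rewrite eA; nra.
have -> : 2 * (b ^+ 2 - a ^+ 2) / S ^+ 2 = 2^-1 * (4 * (b ^+ 2 - a ^+ 2) / S ^+ 2).
  by field; rewrite gt_eqF // .
lra.
Qed.

End PotentialSums.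

(** * The shear: logarithmic growth, boundedness, a lower bound in a cone *)

(** A square with its corner v on top and on the left: it extends towards the
    horizontal axis, so that blocks of cone vertices of a box stay in the box. *)
Definition block (v : vertex) : seq vertex :=
  [:: v; (v.1 + 1, v.2); (v.1, v.2 - 1); (v.1 + 1, v.2 - 1)].
Definition cone (v : vertex) : bool := [&& 0 <= v.1, 2 * v.1 <= v.2 & 8 <= v.2].

Section ShearSums.
Variable R : realType.
Local Notation pot := (@potential R).

Definition quad n : R := \sum_(i < n.+1) \sum_(j < n.+1) `|shear R (i%:Z, j%:Z)|.

Lemma quadS n : quad n.+1 = quad n + 2 * \sum_(i < n.+1) `|shear R (i%:Z, n.+1%:Z)|.
Proof.
rewrite /quad big_ord_recr /= (eq_bigr (fun i : 'I_n.+1 =>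
  (\sum_(j < n.+1) `|shear R (i%:Z, j%:Z)|) +
  `|shear R (i%:Z, n.+1%:Z)|)); last first.
  by move=> i _; rewrite big_ord_recr.
rewrite big_split /= [X in _ + X = _]big_ord_recr /= shear_diag normr0 addr0.
rewrite [X in _ + X = _](eq_bigr (fun i : 'I_n.+1 => `|shear R (i%:Z, n.+1%:Z)|)); last first.
  by move=> i _; rewrite shearC normrN.
by lra.
Qed.

(** A monotone quantity: by [shell_sum] each new row and column increases the
    quadrant sum by at most the decrease of the other terms. *)
Lemma quad_le n : (0 < n)%N ->
  quad n + 2 * outflow R n - 2 * ln (2 * n%:R + 1) + n%:R^-1 <=
  quad 1 + 2 * outflow R 1 - 2 * ln (2 * 1%:R + 1) + 1%:R^-1.
Proof.
case: n => // n _; elim: n => [//|n IH]; apply: le_trans IH.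
rewrite quadS (eq_bigr (fun i : 'I_n.+2 => shear R (i%:Z, n.+2%:Z))); last first.
  move=> i _; rewrite ger0_norm //; apply: le_trans (shear_ge R _ _) => //.
  by rewrite mulr_ge0 ?mulr_ge0 ?invr_ge0 ?sqr_ge0 // subr_ge0 ler_sqr ?nnegrE // ler_nat ltnW.
have := shell_sum R (ltn0Sn n).
have -> : 2 * n.+1%:R + 3 = 2 * n.+2%:R + 1 :> R by rewrite -[n.+2%:R]natr1; ring.
have aux (k s o o' l l' i i' : R) : s + o' - o <= l' - l + 2^-1 * (i - i') ->
  k + 2 * s + 2 * o' - 2 * l' + i' <= k + 2 * o - 2 * l + i by lra.
exact: aux.
Qed.

(** The leading constant matters: 8 = 4 quadrants times 2, against the growth
    2 ln n of the potential. *)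
Lemma sum_shear_le : exists C : R, forall n,
  \sum_(v <- box n) `|shear R v| <= 8 * ln n.+1%:R + C.
Proof.
pose C0 := quad 1 + 2 * outflow R 1 - 2 * ln (2 * 1%:R + 1) + 1%:R^-1.
exists (4 * (quad 0 + `|C0| + 2 * ln 2)) => n.
have h : \sum_(v <- box n) `|shear R v| <= 4 * quad n.
  rewrite sum_box.
  apply: (@le_trans _ _ (2 * \sum_(i < n.+1) \sum_(y <- int_range n) `|shear R (i%:Z, y)|)).
    apply: (@sum_int_range_le _ n (fun x => \sum_(y <- int_range n) `|shear R (x, y)|)).
      by move=> x; rewrite sumr_ge0.
    by move=> x; apply: eq_bigr => y _; rewrite shearNl.
  rewrite [4](_ : _ = 2 * 2); last by lra.
  rewrite -mulrA ler_pM2l // mulr_sumr; apply: ler_sum => i _.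
  apply: (@sum_int_range_le _ n (fun y => `|shear R (i%:Z, y)|)) => // y.
  by rewrite shearNr.
apply: le_trans h _.
have l2 : 0 <= ln 2 :> R by rewrite ln_ge0 //; lra.
have q0 : 0 <= quad 0 by rewrite sumr_ge0 // => i _; rewrite sumr_ge0.
case: n => [|n]; first by rewrite ln1; have := normr_ge0 C0; lra.
have := quad_le (ltn0Sn n); rewrite -/C0.
have := outflow_ge0 R (ltn0Sn n).
have : 0 <= n.+1%:R^-1 :> R by rewrite invr_ge0.
have : C0 <= `|C0| by rewrite ler_norm.
have : ln (2 * n.+1%:R + 1) <= ln 2 + ln n.+2%:R :> R.
  rewrite -lnM ?posrE // ler_ln ?posrE; rewrite -?(natr1 n.+1).
  - by lra.
  - by rewrite ltr_wpDl // mulr_ge0.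
  - by rewrite mulr_gt0 // ltr_wpDl.
have aux (k k' o l l1 l' i a c : R) : l1 <= l + l' -> c <= a -> 0 <= i -> 0 <= o ->
  k + 2 * o - 2 * l1 + i <= c -> 0 <= l -> 0 <= k' ->
  4 * k <= 8 * l' + 4 * (k' + a + 2 * l) by lra.
by move=> h1 h2 h3 h4 h5; apply: aux h1 h2 h3 h4 h5 _ _.
Qed.

Lemma pot_adjacent v w : (absz (w.1 - v.1)%R + absz (w.2 - v.2)%R <= 1)%N ->
  pot w <= pot v + ln 126.
Proof.
move=> h.
have l : ln (126^-1) = - ln 126 :> R by rewrite lnV ?posrE; lra.
rewrite {1}/potential sqnormE radial_log_nat; case: eqP => h1.
  by have := pot_ge R v; have : 0 <= ln 126 :> R by [rewrite ln_ge0; lra]; lra.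
rewrite /potential sqnormE radial_log_nat; case: eqP => h2.
  have -> : (absz w.1 ^ 2 + absz w.2 ^ 2 = 1)%N.
    have [v1 v2] : v.1 = 0 /\ v.2 = 0.
      by move/eqP: h2; rewrite addn_eq0 !expn_eq0 /= !andbT => /andP[]; lia.
    move: h h1; rewrite v1 v2 !subr0 -!mulnn.
    by move: (absz w.1) (absz w.2) => [|[|a]] [|[|b]].
  by rewrite lnV ?posrE ?addNr //; rewrite ln_le0 //; lra.
have {}h1 : (1 <= absz w.1 ^ 2 + absz w.2 ^ 2)%N by rewrite lt0n; apply/eqP.
have {}h2 : (1 <= absz v.1 ^ 2 + absz v.2 ^ 2)%N by rewrite lt0n; apply/eqP.
have sq (k : nat) : (k.+1 * k.+1 <= 2 * (k * k) + 2)%N.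
  by case: k => // k; rewrite !(mulSn, mulnS); lia.
have h3 : (absz w.1 ^ 2 + absz w.2 ^ 2 <= 4 * (absz v.1 ^ 2 + absz v.2 ^ 2))%N.
  have : (absz w.1 <= absz v.1 /\ absz w.2 <= (absz v.2).+1 \/
          absz w.2 <= absz v.2 /\ absz w.1 <= (absz v.1).+1)%N by lia.
  move: h2; rewrite -!mulnn.
  move: (absz v.1) (absz v.2) (absz w.1) (absz w.2) => a b c d h2 [[h3 h4]|[h3 h4]].
    have := leq_mul h3 h3; have := leq_mul h4 h4; have := sq b; lia.
  have := leq_mul h3 h3; have := leq_mul h4 h4; have := sq a; lia.
move: (_ + _)%N (_ + _)%N h1 h2 h3 => N M.
rewrite -!(ler_nat R) natrM => h1 h2 h3.
rewrite -lnM ?posrE; [|lra..].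
by rewrite ler_ln ?posrE; lra.
Qed.

Lemma shear_bounded v : `|shear R v| <= 2 * ln 126.
Proof.
case: v => x y.
have a w : (absz (w.1 - x)%R + absz (w.2 - y)%R <= 1)%N ->
    pot w <= pot (x, y) + ln 126 /\ pot (x, y) <= pot w + ln 126.
  case: w => s t /= h; split; apply: pot_adjacent => //=.
  by rewrite -(abszN (x - s)) -(abszN (y - t)) !opprB.
have := a (x + 1, y) ltac:(rewrite /=; lia).
have := a (x - 1, y) ltac:(rewrite /=; lia).
have := a (x, y + 1) ltac:(rewrite /=; lia).
have := a (x, y - 1) ltac:(rewrite /=; lia).
move=> [h1 h2] [h3 h4] [h5 h6] [h7 h8].
rewrite ler_norml /shear /hdiff /vdiff /=.
by apply/andP; split; lra.
Qed.

(** A lower bound for the shear on the whole block of a cone vertex, of the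
    right order |v|^-2, so that its sum over a box is still logarithmic. *)
Definition cone_weight v : R := if cone v then (4 * v.2%:~R ^+ 2)^-1 else 0.

Lemma cone_weight_ge0 v : 0 <= cone_weight v.
Proof. by rewrite /cone_weight; case: ifP => // _; rewrite invr_ge0 mulr_ge0 // sqr_ge0. Qed.

Lemma cone_weight_le v w : cone v -> w \in block v -> cone_weight v <= shear R w.
Proof.
move=> hc hw; rewrite /cone_weight hc; case: v hc hw => x y /and3P[/= x0 xy y8].
have [m em] : exists m : nat, m%:Z = x by exists (absz x); lia.
have [n en] : exists m : nat, m%:Z = y by exists (absz y); lia.
move=> hw.
have [k [l [-> hk hl hk' hl']]] : exists k l : nat,
    [/\ w = (k%:Z, l%:Z), (m <= k)%N, (k <= m.+1)%N, (n.-1 <= l)%N & (l <= n)%N].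
  by move: hw; rewrite !inE /= => /or4P[] /eqP ->; 
   [exists m, n|exists m.+1, n|exists m, n.-1|exists m.+1, n.-1];
    split; try lia; congr (_, _); lia.
apply: le_trans (shear_ge R _ _); [|lia|lia].
have e1 : (8 * k <= 5 * n)%N by lia.
have e2 : (7 * n <= 8 * l)%N by lia.
have e3 : (8 <= n)%N by lia.
rewrite -en; move: e1 e2 e3 hl'; rewrite -!(ler_nat R) !natrM => e1 e2 e3 hl'.
have k0 : 0 <= k%:R :> R by [].
rewrite -[n%:Z%:~R]/(n%:R : R).
move: (k%:R : R) (n%:R : R) (l%:R : R) e1 e2 e3 hl' k0 => a c b e1 e2 e3 hl' a0.
have h1 : 4^-1 * (c ^+ 2) >= 0 by rewrite mulr_ge0 // ?invr_ge0 // sqr_ge0.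
have h2 : 4^-1 * (3 / 2 * c ^+ 2) ^+ 2 <= 2 * (b ^+ 2 - a ^+ 2) * c ^+ 2.
  have h : 4^-1 * (9 / 4) * c ^+ 2 <= 2 * (b ^+ 2 - a ^+ 2) by nra.
  by have := ler_wpM2r (sqr_ge0 c) h; lra.
have h3 : a ^+ 2 + b ^+ 2 + 2^-1 <= 3 / 2 * c ^+ 2 by nra.
have h4 : 0 < a ^+ 2 + b ^+ 2 + 2^-1 by nra.
rewrite ler_pdivlMr ?exprn_gt0 //.
rewrite invfM -mulrA -mulrCA ler_pdivrMl; last by nra.
apply: le_trans (_ : 4^-1 * (3 / 2 * c ^+ 2) ^+ 2 <= _); last by lra.
by rewrite ler_pM2l ?invr_gt0 // ler_sqr ?nnegrE; lra.
Qed.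

Lemma cone_weight_le1 v : cone_weight v <= 1.
Proof.
rewrite /cone_weight; case: ifP => // /and3P[_ _ h].
have : 8 <= v.2%:~R :> R by rewrite (ler_int R 8).
move: (v.2%:~R) => a a8; rewrite invf_le1; nra.
Qed.

Lemma cone_weight_shear v : cone_weight v <= `|shear R v|.
Proof.
rewrite {1}/cone_weight; case: ifP => // h.
have := cone_weight_le h (mem_head _ _); rewrite {1}/cone_weight h => /le_trans.
by apply; rewrite ler_norm.
Qed.

Lemma sum_int_range_ge n (F : int -> R) : (forall x, 0 <= F x) ->
  \sum_(i < n.+1) F i%:Z <= \sum_(x <- int_range n) F x.
Proof.
move=> F0; elim: n => [|n IH] /=; first by rewrite big_seq1 big_ord1.
by rewrite !big_cons big_ord_recr /=; have := F0 (- n.+1%:Z); lra.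
Qed.

Lemma sum_cone_weight_ge n :
  8^-1 * (ln n.+1%:R - ln 8) <= \sum_(v <- box n) cone_weight v.
Proof.
rewrite sum_box exchange_big /=.
have h := @sum_int_range_ge n (fun y => \sum_(x <- int_range n) cone_weight (x, y)).
apply: le_trans (h _); last by move=> y; rewrite sumr_ge0 // => x _; rewrite cone_weight_ge0.
apply: (@le_trans _ _ (\sum_(j < n.+1) (if (8 <= j)%N then 8^-1 * j%:R^-1 else 0))).
  elim: n {h} => [|n IH].
    by rewrite big_ord1 /= ln1 sub0r mulrN oppr_le0 mulr_ge0 ?ln_ge0 //; lra.
  rewrite big_ord_recr /=; case: ifP => h8.
    apply: le_trans (_ : 8^-1 * (ln n.+1%:R - ln 8) + 8^-1 * n.+1%:R^-1 <= _);
      last by rewrite lerD2r.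
    rewrite -mulrDr ler_pM2l ?invr_gt0 //.
    have aux (a b c d : R) : a - b <= d -> a - c <= b - c + d by lra.
    apply: aux.
    rewrite -ln_div ?posrE // -natr1 mulrDl divff ?mul1r // le_ln1Dx //.
    by rewrite (lt_le_trans (ltrN10 _)) // invr_ge0.
  have : ln n.+2%:R <= ln 8 :> R by rewrite ler_ln ?posrE // ler_nat; lia.
  move=> h; apply: (@le_trans _ _ 0).
    by rewrite mulr_ge0_le0 ?invr_ge0 // subr_le0.
  by rewrite addr0 sumr_ge0 // => i _; case: ifP.
apply: ler_sum => j _; case: ifP => j8; last first.
  by rewrite sumr_ge0 // => x _; rewrite cone_weight_ge0.
have h' := @sum_int_range_ge n (fun x => cone_weight (x, j%:Z)).
apply: le_trans (h' _); last by move=> y; rewrite cone_weight_ge0.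
rewrite (bigID (fun i : 'I_n.+1 => (i < j./2.+1)%N)) /=.
rewrite -[X in X <= _]addr0 lerD ?sumr_ge0 //; last by move=> i _; rewrite cone_weight_ge0.
rewrite -(@big_ord_widen _ _ _ j./2.+1 n.+1 (fun i => cone_weight (i%:Z, j%:Z))); last first.
  by have := ltn_ord j; lia.
rewrite (eq_bigr (fun=> (4 * j%:R ^+ 2)^-1)); last first.
  by move=> i _; rewrite /cone_weight /cone /= ifT //; have := ltn_ord i; lia.
rewrite sumr_const card_ord -[X in _ <= X]mulr_natl.
have j0 : 8 <= j%:R :> R by rewrite (ler_nat R 8).
have : j%:R <= 2 * (j./2.+1)%:R :> R by rewrite -natrM ler_nat; lia.
move: (j%:R) (j./2.+1%:R) j0 => a b a8 ab.
rewrite invfM -exprVn.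
have a0 : a != 0 by rewrite gt_eqF //; lra.
rewrite (_ : 8^-1 * a^-1 = 2^-1 * a * (4^-1 * a^-1 ^+ 2)); last by field.
by rewrite ler_wpM2r ?mulr_ge0 ?invr_ge0 ?sqr_ge0 //; lra.
Qed.

End ShearSums.

(** * Mean values along the walk and the energy supermartingale *)

Definition sgb (R : realType) (b : bool) : R := if b then 1 else -1.
Arguments sgb {R} b.

Definition label_sum (R : realType) (phi : vertex -> R) (s : seq vertex) (l : labelling) : R :=
  \sum_(v <- s) phi v * sgb (l v).

Lemma sqnorm_le (R : realType) m v : (absz v.1 <= m)%N -> (absz v.2 <= m)%N ->
  sqnorm R v <= 2 * m%:R ^+ 2.
Proof.
move=> h1 h2; rewrite sqnormE -natrX -natrM ler_nat.
by rewrite mul2n -addnn leq_add // leq_exp2r.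
Qed.

Section Walk.
Variables (R : realType) (q : R).
Implicit Types (phi psi : state -> R) (st : state).

(** The expectation of phi after one step of the walk from st. *)
Definition step_mean phi st : R :=
  q * (2^-1 * (phi (hv_step true true st) + phi (hv_step true false st))) +
  (1 - q) * (2^-1 * (phi (hv_step false true st) + phi (hv_step false false st))).

(** The probability that the walk does not visit the origin at times 1, ..., n;
    the starting position is not counted. *)
Fixpoint avoid n st : R :=
  if n is m.+1 then
    step_mean (fun st' => if position st' == (0, 0) then 0 else avoid m st') st
  else 1.

(** The expectation of phi at the minimum of n and the first time that the walk
    is in Z. *)
Fixpoint stopped (Z : pred vertex) phi n st : R :=
  if Z (position st) then phi st else
  if n is m.+1 then step_mean (stopped Z phi m) st else phi st.

Hypothesis q01 : 0 <= q <= 1.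

Lemma step_mean_le phi psi st :
  (forall a b, phi (hv_step a b st) <= psi (hv_step a b st)) ->
  step_mean phi st <= step_mean psi st.
Proof.
move=> h; rewrite /step_mean; have [q0 q1] := andP q01.
rewrite lerD ?ler_wpM2l ?lerD ?subr_ge0 ?invr_ge0 //.
Qed.

Lemma step_meanD phi psi st :
  step_mean (fun s => phi s + psi s) st = step_mean phi st + step_mean psi st.
Proof. by rewrite /step_mean; ring. Qed.

Lemma step_meanZ c phi st :
  step_mean (fun s => c * phi s) st = c * step_mean phi st.
Proof. by rewrite /step_mean; ring. Qed.

Lemma step_mean_cst c st : step_mean (fun=> c) st = c.
Proof. by rewrite /step_mean; field. Qed.

Lemma avoid_le1 n st : avoid n st <= 1.
Proof.
elim: n st => [|n IH] st //=; rewrite -[leRHS](step_mean_cst 1 st).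
by apply: step_mean_le => a b; case: ifP.
Qed.

Lemma avoidS_le n st : avoid n.+1 st <= avoid n st.
Proof.
elim: n st => [|n IH] st; first exact: avoid_le1.
by apply: step_mean_le => a b; case: ifP => // _; apply: IH.
Qed.

Lemma avoid_anti m n st : (m <= n)%N -> avoid n st <= avoid m st.
Proof.
move/subnKC <-; elim: (n - m)%N => [|k IH]; first by rewrite addn0.
by rewrite addnS (le_trans (avoidS_le _ _)).
Qed.

Lemma stopped_super (Z : pred vertex) phi :
  (forall st, ~~ Z (position st) -> step_mean phi st <= phi st) ->
  forall n st, stopped Z phi n st <= phi st.
Proof.
move=> h; elim=> [|n IH] st /=; first by case: ifP.
case: ifPn => // zs; apply: le_trans (h _ zs); exact: step_mean_le.
Qed.

Lemma stopped_le (Z : pred vertex) phi psi n st : (forall s, phi s <= psi s) ->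
  stopped Z phi n st <= stopped Z psi n st.
Proof.
move=> h; elim: n st => [|n IH] st /=; first by case: ifP.
case: ifPn => // zs; exact: step_mean_le.
Qed.

Lemma stopped_cst (Z : pred vertex) c n st : stopped Z (fun=> c) n st = c.
Proof.
elim: n st => [|n IH] st /=; first by case: ifP.
case: ifP => // _; rewrite -[RHS](step_mean_cst c st) /step_mean !IH //.
Qed.

Lemma stoppedD (Z : pred vertex) phi psi n st :
  stopped Z (fun s => phi s + psi s) n st = stopped Z phi n st + stopped Z psi n st.
Proof.
elim: n st => [|n IH] st /=; first by case: ifP.
by case: ifP => // _; rewrite -step_meanD /step_mean !IH.
Qed.

Lemma stoppedZ (Z : pred vertex) c phi n st :
  stopped Z (fun s => c * phi s) n st = c * stopped Z phi n st.
Proof.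
elim: n st => [|n IH] st /=; first by case: ifP.
by case: ifP => // _; rewrite -step_meanZ /step_mean !IH.
Qed.

Lemma stopped_sum (Z : pred vertex) (I : Type) (s : seq I) (phi : I -> state -> R) n st :
  stopped Z (fun x => \sum_(i <- s) phi i x) n st = \sum_(i <- s) stopped Z (phi i) n st.
Proof.
elim: s => [|i s IH].
  rewrite big_nil -[RHS](stopped_cst Z 0 n st); congr stopped.
  by apply/funext => x; rewrite big_nil.
rewrite big_cons -IH -stoppedD; congr stopped; apply/funext => x; by rewrite big_cons.
Qed.

Variable n : nat.

Definition halted (v : vertex) : bool := (v == (0, 0)) || (v \notin box n).
Definition exited st : R := (position st \notin box n)%:R.
Definition running st : R := (~~ halted (position st))%:R.

(** The squared distance to the origin increases by exactly 1 on average at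
    each step, whatever the labels, so |X|^2 minus time is a martingale and the
    expected time to leave the box or reach the origin is O(n^2). *)
Lemma stopped_running_le k st : ~~ halted (position st) ->
  k%:R * stopped halted running k st <= 2 * n.+1%:R ^+ 2 - sqnorm R (position st).
Proof.
have r01 m s : 0 <= stopped halted running m s <= 1.
  rewrite -{1}(stopped_cst halted 0 m s) -[X in _ <= _ <= X](stopped_cst halted 1 m s).
  by rewrite !stopped_le // => x; rewrite /running; case: halted.
elim: k st => [|k IH] st zs.
  rewrite mul0r subr_ge0; move: zs; rewrite /halted negb_or negbK mem_box => /and3P[_ h1 h2].
  by apply: sqnorm_le; exact: leqW.
rewrite /= (negbTE zs) -step_meanZ.
apply: (@le_trans _ _ (step_mean (fun s =>
    2 * n.+1%:R ^+ 2 + 1 + -1 * sqnorm R (position s)) st)).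
  apply: step_mean_le => a b; set s := hv_step a b st.
  have [zs'|zs'] := boolP (halted (position s)).
    have -> : stopped halted running k s = 0.
      by case: k {IH} => [|k] /=; rewrite zs' /running zs'.
    rewrite mulr0 mulN1r subr_ge0 ler_wpDr //.
    move: zs; rewrite /halted negb_or negbK mem_box => /and3P[_ h1 h2].
    apply: sqnorm_le; rewrite /s /hv_step /=; case: (_ (+) _); case: (b) => /=;
      move: h1 h2; case: (position st) => x y /= h1 h2; lia.
  have := IH _ zs'; have := r01 k s; rewrite -natr1; lra.
rewrite step_meanD step_mean_cst step_meanZ.
suff -> : step_mean (fun s => sqnorm R (position s)) st = sqnorm R (position st) + 1 by lra.
rewrite /step_mean /hv_step /sqnorm /=.
by case: (labels _ _) => /=; rewrite !(intrD, mulrNz, mulr1z); field.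
Qed.

Lemma avoid_le_stopped k st : position st != (0, 0) ->
  avoid k st <= stopped halted exited k st + stopped halted running k st.
Proof.
rewrite -stoppedD.
have e : (fun s => exited s + running s) = (fun s => (position s != (0, 0))%:R).
  apply/funext => s; rewrite /exited /running /halted.
  case: eqP => [->|_] /=; last by case: (_ \in _); rewrite ?addr0 ?add0r.
  by rewrite mem_box /= addr0.
rewrite e {e}; elim: k st => [|k IH] st x0 /=; first by rewrite x0 if_same.
case: ifPn => zs; first by rewrite x0; exact: (avoid_le1 k.+1 st).
apply: step_mean_le => a b; case: eqP => [h|/eqP]; last exact: IH.
by rewrite -[leLHS](stopped_cst halted 0 k (hv_step a b st)) stopped_le // => s.
Qed.

Lemma label_sum_step (s : seq vertex) (phi : vertex -> R) a b st : uniq s ->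
  label_sum phi s (labels (hv_step a b st)) = label_sum phi s (labels st) -
  (if a && (position st \in s)
   then 2 * phi (position st) * sgb (labels st (position st)) else 0).
Proof.
move=> us; rewrite /label_sum /=; have [xs|xs] := boolP (position st \in s); last first.
  rewrite andbF subr0; apply: eq_big_seq => v vs; case: eqP => // e.
  by move: xs; rewrite -e vs.
rewrite andbT !(bigD1_seq _ xs us) /= eqxx.
rewrite (eq_bigr (fun v => phi v * sgb (labels st v))); last first.
  by move=> v /negbTE ->.
by case: (labels _ _); case: (a) => /=; ring.
Qed.

(** The potential corrected by the labels of the box, a supermartingale for the
    right constant c. *)
Definition energy c st : R :=
  potential R (position st) + 2^-1 * c * label_sum (shear R) (box n) (labels st).

(** The flip of the label at x changes the label term by -c D s with probability
    q, and q c = 1/2 - q is the coefficient of the bias of the walk towards the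
    axis of its current label; the Laplacian of f is what remains. *)
Lemma energy_super c st : q * c = 2^-1 - q -> ~~ halted (position st) ->
  step_mean (energy c) st <= energy c st.
Proof.
move=> qc; rewrite /halted negb_or negbK => /andP[x0 xb].
have hv := potential_superharmonic R x0.
suff -> : step_mean (energy c) st = energy c st +
  2^-1 * (hdiff R (position st) + vdiff R (position st)) by lra.
rewrite /step_mean /energy !(label_sum_step _ _ _ _ (box_uniq n)) xb /=.
move: (label_sum _ _ _) => L.
have qq (D : R) : q * c * D = (2^-1 - q) * D by rewrite qc.
have := qq (shear R (position st)).
rewrite /shear /hdiff /vdiff.
case: (labels _ _) => /=; rewrite /sgb;
move: (potential R _) (potential R _) (potential R _) (potential R _)
  (potential R _) => p0 p1 p2 p3 p4 h.
- by lra.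
- by lra.
Qed.

End Walk.

(** * Lengthening paths at their last visit to a block *)

Section Insertion.
Variables (R : realType) (Z : pred vertex) (v : vertex).
Hypothesis hB : forall w, w \in block v -> ~~ Z w.
Implicit Types (phi psi : state -> R) (st : state).
Local Notation B := (block v).

Definition aligned st : bool := all (labels st) B.
(** For a certain flip, the labels of the block after the next step. *)
Definition aligned_after st : bool := all (fun w => labels st w (+) (w == position st)) B.
(** The states from which a step out of the block, if it is the last one, fixes
    the final labels of the block: all H when beta holds, not all H otherwise. *)
Definition departs (beta : bool) st : bool := (position st \in B) && (aligned_after st == beta).

Definition half_sum phi st : R :=
  2^-1 * (phi (hv_step true true st) + phi (hv_step true false st)).

(** The transition operator of the walk with q = 1, killed in Z. *)
Definition killed_step phi st : R := if Z (position st) then 0 else half_sum phi st.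

(** The probability of reaching Z within n steps without visiting the block. *)
Fixpoint escape n st : R :=
  if position st \in B then 0 else if Z (position st) then 1 else
  if n is m.+1 then half_sum (escape m) st else 0.

(** The probability that the walk visits the block, is halted in Z within n
    steps, and leaves the block for the last time in the way described by
    beta; the sum over the time of the last visit, written as a recursion. *)
Fixpoint last_visit beta n st : R :=
  if n is m.+1 then
    (departs beta st)%:R * half_sum (escape m) st + killed_step (last_visit beta m) st
  else 0.

Definition ends beta n st : R :=
  stopped 1 Z (fun s => (Z (position s) && (aligned s == beta))%:R) n st.

Lemma step_mean1 phi st : step_mean 1 phi st = half_sum phi st.
Proof. by rewrite /step_mean /half_sum; ring. Qed.

Lemma half_sum_ge0 phi st : (forall s, 0 <= phi s) -> 0 <= half_sum phi st.
Proof. by move=> h; rewrite mulr_ge0 ?addr_ge0 ?invr_ge0. Qed.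

Lemma killed_step_ge0 phi st : (forall s, 0 <= phi s) -> 0 <= killed_step phi st.
Proof. by move=> h; rewrite /killed_step; case: ifP => // _; exact: half_sum_ge0. Qed.

Lemma escape_ge0 n st : 0 <= escape n st.
Proof.
by elim: n st => [|n IH] st /=; do 2?case: ifP => // _; exact: half_sum_ge0.
Qed.

Lemma last_visit_ge0 beta n st : 0 <= last_visit beta n st.
Proof.
elim: n st => [//|n IH] st /=; rewrite addr_ge0 ?killed_step_ge0 // mulr_ge0 //.
by apply: half_sum_ge0 => s; exact: escape_ge0.
Qed.

Lemma last_visit_halted beta n st : Z (position st) -> last_visit beta n st = 0.
Proof.
case: n => [//|n] zs /=; rewrite /killed_step zs /departs.
by case: (boolP (_ \in B)) => [/hB|_]; rewrite ?zs // mul0r addr0.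
Qed.

Lemma aligned_step b st : aligned (hv_step true b st) = aligned_after st.
Proof.
apply: eq_all => w /=; case: eqP => [->|_]; by rewrite ?addbF.
Qed.

Lemma aligned_step_out b st : position st \notin B ->
  aligned (hv_step true b st) = aligned st.
Proof.
move=> x0; apply: eq_in_all => w wB /=; case: eqP => // e.
by move: x0; rewrite -e wB.
Qed.

(** Last-visit decomposition: the final labels of the block are those of its last
    visit, or the initial ones when the block is never visited. *)
Lemma ends_decomp beta n st :
  ends beta n st = last_visit beta n st + (aligned st == beta)%:R * escape n st.
Proof.
elim: n st => [|n IH] st.
  rewrite /ends /= add0r; case: ifP => zs /=; rewrite zs.
    by case: ifP => [/hB|_]; rewrite ?zs // mulr1.
  by case: ifP => _; rewrite mulr0.
have [zs|zs] := boolP (Z (position st)).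
  rewrite last_visit_halted // add0r /ends /= zs /=.
  by case: ifP => [/hB|_]; rewrite ?zs // mulr1.
rewrite {1}/ends /= (negbTE zs) step_mean1 /killed_step (negbTE zs).
rewrite /half_sum -/(ends beta n _) -/(ends beta n _) !IH.
have [xB|xB] := boolP (position st \in B).
  rewrite !aligned_step /departs xB /= mulr0 addr0.
  by case: (_ == _); rewrite ?mul1r ?mul0r; lra.
rewrite !aligned_step_out // /departs (negbTE xB) /= mul0r add0r.
by case: (_ == _); rewrite ?mul1r ?mul0r; lra.
Qed.

(** Before its next visit to the block the walk does not see the labels there;
    this is why the detour does not change the future of the path. *)
Lemma escape_ext n st st' : position st = position st' ->
  (forall w, w \notin B -> labels st w = labels st' w) ->
  escape n st = escape n st'.
Proof.
elim: n st st' => [|n IH] st st' e h; first by rewrite /= e.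
rewrite /= e; case: ifPn => // xB; case: ifP => // _.
rewrite /half_sum; congr (_ * (_ + _)); apply: IH; rewrite /hv_step /= e h //.
- by move=> w wB; case: eqP => // _; exact: h.
- by move=> w wB; case: eqP => // _; exact: h.
Qed.

Lemma killed_step_half phi st b : (forall s, 0 <= phi s) -> ~~ Z (position st) ->
  2^-1 * phi (hv_step true b st) <= killed_step phi st.
Proof.
move=> h zs; rewrite /killed_step (negbTE zs) /half_sum.
have := h (hv_step true true st); have := h (hv_step true false st).
by case: b; lra.
Qed.

Lemma killed_step_le phi psi st : (forall s, phi s <= psi s) ->
  killed_step phi st <= killed_step psi st.
Proof.
move=> h; rewrite /killed_step; case: ifP => // _.
by rewrite ler_wpM2l ?invr_ge0 // lerD.
Qed.

Definition run (bs : seq bool) st : state := foldl (fun s b => hv_step true b s) st bs.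

Lemma iter_killed_ge0 phi k st : (forall s, 0 <= phi s) -> 0 <= iter k killed_step phi st.
Proof. by move=> h; elim: k st => [|k IH] st //=; exact: killed_step_ge0. Qed.

Lemma iter_killed_run phi bs st : (forall s, 0 <= phi s) ->
  (forall i, (i < size bs)%N -> ~~ Z (position (run (take i bs) st))) ->
  2^-1 ^+ size bs * phi (run bs st) <= iter (size bs) killed_step phi st.
Proof.
move=> h; elim: bs st => [|b bs IH] st hz /=; first by rewrite expr0 mul1r.
rewrite exprS -mulrA.
apply: le_trans (killed_step_half b _ (hz 0%N isT)); last by move=> s; exact: iter_killed_ge0.
rewrite ler_wpM2l ?invr_ge0 //; apply: IH => i hi.
exact: (hz i.+1).
Qed.

Definition dir (b : bool) : int := if b then 1 else -1.

Definition relabel (l : labelling) x c : labelling := fun y => if y == x then c else l y.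

Lemma hv_step_false x l b : l x = false ->
  hv_step true b (State x l) = State (x.1 + dir b, x.2) (relabel l x true).
Proof. by move=> e; rewrite /hv_step /= e. Qed.

Lemma hv_step_true x l b : l x = true ->
  hv_step true b (State x l) = State (x.1, x.2 + dir b) (relabel l x false).
Proof. by move=> e; rewrite /hv_step /= e. Qed.

Lemma block_square x : x \in B -> exists h u : bool,
  [/\ (x.1 + dir h, x.2) \in B, (x.1 + dir h, x.2 + dir u) \in B &
      (x.1, x.2 + dir u) \in B].
Proof.
rewrite /block !inE; case: v => a c /= /or4P[] /eqP -> /=;
  [exists true, false|exists false, false|exists true, true|exists false, true];
  rewrite /dir /= ?addrK ?addrNK; split; by rewrite !inE /= ?eqxx ?orbT.
Qed.

(** Let p0 be the position, p1 and p3 its horizontal and vertical neighbours in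
    the block, and p2 the opposite corner. The labels are V at p0 and H at the
    others, since the flip at p0 is to produce four H. The walk can go p0, p1,
    p2, p1, p0, p3, p0: it flips p0 and p1 twice, p2 and p3 once. *)
Lemma detour st : departs true st -> exists bs : seq bool,
  [/\ size bs = 6%N,
      forall i, (i < 6)%N -> position (run (take i bs) st) \in B,
      departs false (run bs st),
      position (run bs st) = position st /\
      labels (run bs st) (position st) = labels st (position st) &
      forall w, w \notin B -> labels (run bs st) w = labels st w].
Proof.
case/andP=> xB /eqP/allP al; have [h [u [B1 B2 B3]]] := block_square xB.
case: st xB al B1 B2 B3 => x l /=; case: x => a c /= xB al B1 B2 B3.
have dN b : dir (~~ b) = - dir b by case: b; rewrite /dir /= ?opprK.
have d0 b : dir b == 0 = false by case: b.
have dd b k : (k + dir b == k) = false by rewrite -subr_eq0 addrAC subrr add0r d0.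
have dd' b k : (k == k + dir b) = false by rewrite eq_sym dd.
have l0 : l (a, c) = false by have /= := al _ xB; rewrite eqxx addbT => /negbTE.
have l1 : l (a + dir h, c) = true by have /= := al _ B1; rewrite xpair_eqE dd addbF.
have l2 : l (a + dir h, c + dir u) = true by have /= := al _ B2; rewrite xpair_eqE dd addbF.
have l3 : l (a, c + dir u) = true by have /= := al _ B3; rewrite xpair_eqE dd andbF addbF.
pose m1 := relabel l (a, c) true.
pose m2 := relabel m1 (a + dir h, c) false.
pose m3 := relabel m2 (a + dir h, c + dir u) false.
pose m4 := relabel m3 (a + dir h, c) true.
pose m5 := relabel m4 (a, c) false.
pose m6 := relabel m5 (a, c + dir u) false.
have eqs := (xpair_eqE, eqxx, dd, dd', andbF, andbT, andFb).
have s1 : hv_step true h (State (a, c) l) = State (a + dir h, c) m1.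
  by rewrite hv_step_false.
have s2 : hv_step true u (State (a + dir h, c) m1) = State (a + dir h, c + dir u) m2.
  by rewrite hv_step_true // /m1 /relabel !eqs.
have s3 : hv_step true (~~ u) (State (a + dir h, c + dir u) m2) = State (a + dir h, c) m3.
  by rewrite hv_step_true ?dN ?addrK //= /m2 /m1 /relabel !eqs.
have s4 : hv_step true (~~ h) (State (a + dir h, c) m3) = State (a, c) m4.
  by rewrite hv_step_false ?dN ?addrK //= /m3 /m2 /m1 /relabel !eqs.
have s5 : hv_step true u (State (a, c) m4) = State (a, c + dir u) m5.
  by rewrite hv_step_true //= /m4 /m3 /m2 /m1 /relabel !eqs.
have s6 : hv_step true (~~ u) (State (a, c + dir u) m5) = State (a, c) m6.
  by rewrite hv_step_true ?dN ?addrK //= /m5 /m4 /m3 /m2 /m1 /relabel !eqs.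
exists [:: h; u; ~~ u; ~~ h; u; ~~ u]; rewrite /run.
have final : foldl (fun s b => hv_step true b s) (State (a, c) l)
    [:: h; u; ~~ u; ~~ h; u; ~~ u] = State (a, c) m6.
  by rewrite /= s1 s2 s3 s4 s5 s6.
rewrite final /=; split => //.
- case=> [|[|[|[|[|[|i]]]]]] hi; last by [].
  + exact: xB.
  + by rewrite [take _ _]/= [foldl _ _ _]/= s1.
  + by rewrite [take _ _]/= [foldl _ _ _]/= s1 s2.
  + by rewrite [take _ _]/= [foldl _ _ _]/= s1 s2 s3.
  + by rewrite [take _ _]/= [foldl _ _ _]/= s1 s2 s3 s4.
  + by rewrite [take _ _]/= [foldl _ _ _]/= s1 s2 s3 s4 s5.
- rewrite /departs /= xB /=; apply/eqP/allPn; exists (a, c + dir u) => //.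
  by rewrite /m6 /relabel /= !eqs.
- by rewrite /m6 /m5 /relabel !eqs l0.
- move=> w wB; rewrite /m6 /m5 /m4 /m3 /m2 /m1 /relabel.
  do ! (case: eqP => [e|_]; first by move: wB; rewrite e ?xB ?B1 ?B2 ?B3).
  by [].
Qed.

(** The detour has probability 2^-6 and ends in a state with the same position,
    the same label there and the same labels off the block. *)
Lemma iter_departs n st :
  2^-1 ^+ 6 * ((departs true st)%:R * half_sum (escape n) st) <=
  iter 6 killed_step (fun s => (departs false s)%:R * half_sum (escape n) s) st.
Proof.
have ge0 s : 0 <= (departs false s)%:R * half_sum (escape n) s.
  by rewrite mulr_ge0 // half_sum_ge0 // => s'; exact: escape_ge0.
have [ds|ds] := boolP (departs true st); last first.
  by rewrite mul0r mulr0 iter_killed_ge0.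
have [bs [sz inB dF [e1 e2] e3]] := detour ds.
have := @iter_killed_run (fun s => (departs false s)%:R * half_sum (escape n) s) bs st ge0.
rewrite sz dF !mul1r => /(_ (fun i hi => hB (inB i hi))).
congr (_ * _ <= _); rewrite /half_sum; congr (_ * (_ + _)); apply: escape_ext.
all: try by rewrite /hv_step /= e1 e2.
all: by move=> w wB; rewrite /hv_step /= e1; case: eqP => // _; rewrite ?e2 ?e3.
Qed.

Lemma killed_stepD phi psi st :
  killed_step (fun s => phi s + psi s) st = killed_step phi st + killed_step psi st.
Proof. by rewrite /killed_step /half_sum; case: ifP => _; ring. Qed.

Lemma killed_stepZ c phi st :
  killed_step (fun s => c * phi s) st = c * killed_step phi st.
Proof. by rewrite /killed_step /half_sum; case: ifP => _; ring. Qed.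

Lemma iter_killedD k phi psi st :
  iter k killed_step (fun s => phi s + psi s) st =
  iter k killed_step phi st + iter k killed_step psi st.
Proof.
elim: k st => [//|k IH] st /=; rewrite -killed_stepD.
by congr killed_step; apply/funext.
Qed.

Lemma last_visit_detour n st :
  2^-1 ^+ 6 * last_visit true n st <= iter 6 killed_step (last_visit false n) st.
Proof.
elim: n st => [|n IH] st; first by rewrite mulr0 iter_killed_ge0.
rewrite [X in _ <= X](iter_killedD 6
  (fun s => (departs false s)%:R * half_sum (escape n) s) (killed_step (last_visit false n))).
rewrite [last_visit true _ _]/= mulrDr lerD ?iter_departs // -killed_stepZ.
rewrite -iterSr iterS; exact: killed_step_le.
Qed.

Lemma ends_ge0 beta n st : 0 <= ends beta n st.
Proof.
rewrite ends_decomp addr_ge0 ?last_visit_ge0 // mulr_ge0 //; exact: escape_ge0.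
Qed.

Lemma ends_killed beta n st : killed_step (ends beta n) st <= ends beta n.+1 st.
Proof.
rewrite /killed_step; case: ifP => zs; first exact: ends_ge0.
by rewrite {2}/ends /= zs step_mean1.
Qed.

Lemma ends_iter beta k n st : iter k killed_step (ends beta n) st <= ends beta (k + n) st.
Proof.
elim: k st => [//|k IH] st; rewrite iterS addSn.
by apply: le_trans (ends_killed _ _ _); exact: killed_step_le.
Qed.

Lemma iter_killed_le k phi psi st : (forall s, phi s <= psi s) ->
  iter k killed_step phi st <= iter k killed_step psi st.
Proof.
by move=> h; elim: k st => [|k IH] st //=; exact: killed_step_le.
Qed.

Lemma endsS beta n st : ends beta n st <= ends beta n.+1 st.
Proof.
elim: n st => [|n IH] st; have [zs|zs] := boolP (Z (position st)).
- by rewrite /ends /= zs.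
- by rewrite {1}/ends /= (negbTE zs) /= ends_ge0.
- by rewrite /ends /= zs.
- rewrite {1}/ends [leRHS]/ends /= (negbTE zs) !step_mean1.
  by rewrite ler_wpM2l ?invr_ge0 // lerD //; exact: IH.
Qed.

Lemma ends_mono beta k n st : ends beta n st <= ends beta (k + n) st.
Proof. by elim: k => [//|k IH]; rewrite addSn (le_trans IH) // endsS. Qed.

(** The constant is 65 = 1 + 2^6: paths that end with an aligned block have at
    most 2^6 times the probability of those that end with a misaligned one. *)
Lemma misaligned_end n st : ~~ aligned st ->
  65^-1 * stopped 1 Z (fun s => (Z (position s))%:R) n st <= ends false (6 + n) st.
Proof.
move=> as0.
have h1 : ends true n st <= 64 * ends false (6 + n) st.
  have := last_visit_detour n st.
  have := @iter_killed_le 6 (last_visit false n) (ends false n) st.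
  have := ends_iter false 6 n st.
  rewrite (ends_decomp true) (negbTE as0) /= mul0r addr0 => h1 /(_ _) h2 h3.
  have h4 : 2^-1 ^+ 6 * last_visit true n st <= ends false (6 + n) st.
    apply: le_trans h3 _; apply: le_trans (h2 _) h1 => s.
    by rewrite ends_decomp lerDl mulr_ge0 // escape_ge0.
  have e : 2^-1 ^+ 6 = 64^-1 :> R by field.
  by rewrite -ler_pdivrMl // -e.
have h2 := ends_mono false 6 n st.
have -> : stopped 1 Z (fun s => (Z (position s))%:R) n st = ends true n st + ends false n st.
  rewrite /ends -stoppedD; congr stopped; apply/funext => s.
  by case: (Z _); case: (aligned s); rewrite /= ?addr0 ?add0r.
lra.
Qed.

End Insertion.

(** * The hitting bound *)

Section Hit.
Variable R : realType.
Implicit Types (st : state) (l : labelling).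

(** What typical means for labels: along a sequence of radii, both label sums
    used below are negligible with respect to the logarithm of the radius. *)
Definition balanced l : Prop := forall (e : R) m, 0 < e -> exists n : nat,
  [/\ (m <= n)%N,
      `|label_sum (shear R) (box n) l| <= e * ln n.+1%:R &
      `|label_sum (cone_weight R) (box n) l| <= e * ln n.+1%:R].

Lemma ln_unbounded (K : R) : exists m : nat, forall n, (m <= n)%N -> K <= ln n.+1%:R.
Proof.
exists (Num.bound (expR K)) => n mn.
rewrite -[leLHS]expRK ler_ln ?posrE ?expR_gt0 //.
apply: le_trans (ltW (archi_boundP (expR_ge0 K))) _.
by rewrite ler_nat leqW.
Qed.

(** A single label changes and the weights are bounded, while ln n tends to
    infinity. *)
Lemma balanced_step a b st : balanced (labels st) -> balanced (labels (hv_step a b st)).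
Proof.
move=> bal e m e0.
have [m1 hm1] := ln_unbounded (2 * (2 * (2 * ln 126 + 1)) / e).
have [n [mn h1 h2]] := bal (e / 2) (maxn m m1) ltac:(by rewrite divr_gt0).
exists n; split; first by lia.
all: have hl := hm1 n ltac:(lia).
all: have {}hl : 2 * (2 * ln 126 + 1) <= e / 2 * ln n.+1%:R.
1,3: by move: hl; rewrite ler_pdivrMr //; lra.
all: have l126 : 0 <= ln 126 :> R by rewrite ln_ge0 //; lra.
all: rewrite (label_sum_step _ _ _ _ (box_uniq n)).
all: apply: le_trans (ler_normB _ _) _.
all: have sb (x : bool) : `|sgb x : R| = 1 by case: x; rewrite /sgb ?normrN normr1.
- have : `|if a && (position st \in box n)
      then 2 * shear R (position st) * sgb (labels st (position st)) else 0|
      <= 2 * (2 * ln 126 + 1).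
    case: ifP => _; last by rewrite normr0; lra.
    by rewrite !normrM sb ger0_norm //; have := shear_bounded R (position st); lra.
  lra.
- have : `|if a && (position st \in box n)
      then 2 * cone_weight R (position st) * sgb (labels st (position st)) else 0|
      <= 2 * (2 * ln 126 + 1).
    case: ifP => _; last by rewrite normr0; lra.
    rewrite !normrM sb ger0_norm // ger0_norm ?cone_weight_ge0 //.
    by have := cone_weight_le1 R (position st); lra.
  lra.
Qed.

Lemma pot_exited n st :
  2 * ln n.+1%:R * exited R n st - ln 126 <= potential R (position st).
Proof.
have l126 : 0 <= ln 126 :> R by rewrite ln_ge0 //; lra.
have l : ln (126^-1) = - ln 126 :> R by rewrite lnV ?posrE; lra.
have l2 : ln 2 <= ln 126 :> R by rewrite ler_ln ?posrE //; lra.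
have := pot_ge R (position st); rewrite /exited; case: (boolP (_ \in _)) => h /=; first by lra.
by have := pot_out R h; lra.
Qed.

Lemma label_sum_norm_le (phi : vertex -> R) s l :
  `|label_sum phi s l| <= \sum_(v <- s) `|phi v|.
Proof.
apply: le_trans (ler_norm_sum _ _ _) _; apply: ler_sum => v _.
by rewrite normrM /sgb; case: (l v); rewrite ?normrN normr1 mulr1.
Qed.

Lemma running_small n st (d : R) : 0 < d -> ~~ halted n (position st) ->
  forall q, 0 <= q <= 1 ->
  exists m, forall k, (m <= k)%N -> stopped q (halted n) (running R n) k st <= d.
Proof.
move=> d0 hs q q01.
exists (Num.bound (2 * n.+1%:R ^+ 2 / d)).+1 => k mk.
have k0 : 0 < k%:R :> R by rewrite ltr0n; lia.
have := stopped_running_le q01 k hs.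
have := sqnorm_ge0 R (position st) => s0 h.
have h2 : 2 * n.+1%:R ^+ 2 / d < k%:R.
  apply: lt_le_trans (archi_boundP _) _; first by rewrite divr_ge0 ?mulr_ge0 ?sqr_ge0 // ltW.
  by rewrite ler_nat; lia.
move: h2; rewrite ltr_pdivrMr // => h2.
rewrite -(ler_pM2l k0); lra.
Qed.

Definition hit_bound (q : R) : Prop := exists2 d : R, 0 < d <= 1 &
  forall st, balanced (labels st) -> position st != (0, 0) ->
  exists k, avoid q k st <= 1 - d.

(** With d = (1 - 2 |c|) / 4, the potential gains 2 ln n at the exit while the
    labels compensate at most 4 |c| ln n = 2 (1 - 4 d) ln n; the margin absorbs
    the constants and the small sums. *)
Lemma hit_bound_lt1 (q : R) : 3^-1 < q < 1 -> hit_bound q.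
Proof.
move=> /andP[q3 q1]; have q01 : 0 <= q <= 1 by apply/andP; split; lra.
pose c := (2^-1 - q) / q.
have qc : q * c = 2^-1 - q by rewrite /c mulrC divfK //; apply/eqP; lra.
have c1 : `|c| < 2^-1.
  by rewrite ltr_norml; apply/andP; split; rewrite /c ?ltr_pdivlMr ?ltr_pdivrMr; lra.
have c0 := normr_ge0 c.
pose d := (1 - 2 * `|c|) / 4.
have d0 : 0 < d by rewrite /d; lra.
have ed : d = (1 - 2 * `|c|) / 4 by [].
exists d; first by apply/andP; split; lra.
move=> st bal x0.
have [C hC] := sum_shear_le R.
pose K := potential R (position st) + ln 126 + `|C|.
have [m1 hm1] := ln_unbounded (`|K| / d + 1).
have [n [mn h1 _]] := bal d (maxn m1 (maxn (absz (position st).1) (absz (position st).2))) d0.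
have xb : position st \in box n.
  by rewrite mem_box; move: mn; rewrite !geq_max => /and3P[_ -> ->].
have hl := hm1 n ltac:(lia).
have hs : ~~ halted n (position st) by rewrite /halted negb_or x0 xb.
have [k hk] := running_small d0 hs q01.
exists k; apply: le_trans (avoid_le_stopped q01 n k x0) _.
have {}hk := hk k (leqnn k).
have K0 := normr_ge0 K.
have l1 : 1 <= ln n.+1%:R :> R by have : 0 <= `|K| / d by [rewrite divr_ge0 // ltW]; lra.
have lK : `|K| <= d * ln n.+1%:R by rewrite mulrC -ler_pdivrMr //; lra.
have E1 : stopped q (halted n) (energy n c) k st <= energy n c st.
  by apply: stopped_super => // s; exact: energy_super.
have E2 : stopped q (halted n) (fun s => (2 * ln n.+1%:R) * exited R n s +
      (- ln 126 - 2^-1 * `|c| * \sum_(v <- box n) `|shear R v|)) k st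
   <= stopped q (halted n) (energy n c) k st.
  apply: stopped_le => // s; rewrite /energy.
  have := pot_exited n s.
  suff : - (2^-1 * `|c| * \sum_(v <- box n) `|shear R v|) <=
      2^-1 * c * label_sum (shear R) (box n) (labels s) by lra.
  apply: le_trans (lerNnormlW (lexx _)).
  rewrite lerN2 !normrM ger0_norm ?invr_ge0 // ler_wpM2l ?mulr_ge0 ?invr_ge0 //.
  exact: label_sum_norm_le.
move: E2; rewrite stoppedD // stoppedZ // stopped_cst // => E2.
have hen : energy n c st <= potential R (position st) + 4^-1 * (d * ln n.+1%:R).
  rewrite /energy lerD2l; apply: le_trans (ler_norm _) _.
  rewrite -mulrA normrM ger0_norm ?invr_ge0 // normrM.
  rewrite (_ : 4^-1 * _ = 2^-1 * (2^-1 * (d * ln n.+1%:R))); last by field.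
  by rewrite ler_wpM2l ?invr_ge0 // ler_pM // ltW.
have hS := hC n.
have hCC := ler_norm C.
have hKK := ler_norm K.
have cS : `|c| * \sum_(v <- box n) `|shear R v| <= `|c| * (8 * ln n.+1%:R + `|C|).
  by rewrite ler_wpM2l //; lra.
have cC : `|c| * `|C| <= 2^-1 * `|C| by rewrite ler_wpM2r // ltW.
have C0 := normr_ge0 C.
set e := stopped q _ (exited R n) k st in E2 *.
suff : e <= 1 - 3 * d by lra.
have l0 : 0 < 2 * ln n.+1%:R :> R by lra.
rewrite -(ler_pM2l l0).
set L := ln n.+1%:R in E2 l0 lK hen cS l1 *.
have eK : K = potential R (position st) + ln 126 + `|C| by [].
have e8 : L * `|c| = L * 2^-1 - 2 * (L * d) by rewrite ed; field.
lra.
Qed.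

Lemma sum_uniq_subset (s t : seq vertex) (F : vertex -> R) :
  uniq s -> uniq t -> {subset s <= t} -> (forall v, 0 <= F v) ->
  \sum_(v <- s) F v <= \sum_(v <- t) F v.
Proof.
move=> us ut st F0.
rewrite [leRHS](bigID (mem s)) /= [X in _ <= X + _](_ : _ = \sum_(v <- s) F v); last first.
  rewrite -big_filter; apply: perm_big.
  apply: uniq_perm; rewrite ?filter_uniq // => v; rewrite mem_filter /=.
  by case: (boolP (v \in s)) => // /st ->.
by rewrite lerDl sumr_ge0.
Qed.

(** For q = 1 the energy exceeds its worst-case value by half of this at each
    vertex labelled V with positive shear. *)
Definition mislabel_cost l v : R := if l v then 0 else Num.max (shear R v) 0.

Lemma mislabel_cost_ge0 l v : 0 <= mislabel_cost l v.
Proof. by rewrite /mislabel_cost; case: ifP => // _; rewrite le_max lexx orbT. Qed.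

Lemma cone_weight_shift (l : labelling) (n : nat) (tau : vertex -> vertex) : injective tau ->
  (forall v, tau v \in block v) ->
  (forall v, cone v -> v \in box n -> tau v \in box n) ->
  \sum_(v <- box n) cone_weight R v * (~~ l (tau v))%:R <= \sum_(v <- box n) mislabel_cost l v.
Proof.
move=> tinj tB tbox.
apply: (@le_trans _ _ (\sum_(v <- [seq v <- box n | cone v]) mislabel_cost l (tau v))).
  rewrite [leRHS]big_filter [leRHS]big_mkcond /=; apply: ler_sum => v _.
  rewrite {1}/cone_weight; case: ifP => hc; last by rewrite mul0r.
  have := cone_weight_le R hc (tB v); rewrite /cone_weight hc /mislabel_cost.
  by case: (l _) => /=; rewrite ?mulr0 // mulr1 le_max => ->.
rewrite -(big_map tau xpredT (mislabel_cost l)).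
apply: sum_uniq_subset; rewrite ?map_inj_uniq ?filter_uniq ?box_uniq //;
  last exact: mislabel_cost_ge0.
move=> w /mapP[v]; rewrite mem_filter => /andP[vc vb] ->; exact: tbox.
Qed.

(** Every misaligned block contains a vertex labelled V, and each vertex lies in
    at most four blocks. *)
Lemma misaligned_cost (l : labelling) n :
  \sum_(v <- box n) cone_weight R v * (~~ all l (block v))%:R <=
  4 * \sum_(v <- box n) mislabel_cost l v.
Proof.
have h1 := @cone_weight_shift l n (fun v => v) (fun _ _ h => h)
  (fun v => mem_head _ _) (fun _ _ h => h).
have h2 := @cone_weight_shift l n (fun v => (v.1 + 1, v.2)).
have h3 := @cone_weight_shift l n (fun v => (v.1, v.2 - 1)).
have h4 := @cone_weight_shift l n (fun v => (v.1 + 1, v.2 - 1)).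
have {}h2 := h2 _ _ _; have {}h3 := h3 _ _ _; have {}h4 := h4 _ _ _.
apply: le_trans (_ : _ <= \sum_(v <- box n) (cone_weight R v * (~~ l v)%:R +
   (cone_weight R v * (~~ l (v.1 + 1, v.2))%:R + (cone_weight R v * (~~ l (v.1, v.2 - 1))%:R
   + cone_weight R v * (~~ l (v.1 + 1, v.2 - 1))%:R)))) _.
  apply: ler_sum => v _; rewrite -!mulrDr ler_wpM2l ?cone_weight_ge0 //=.
  by case: (l _); case: (l _); case: (l _); case: (l _) => /=; lra.
rewrite !big_split /=.
have : \sum_(v <- box n) cone_weight R v * (~~ l (v.1 + 1, v.2))%:R <=
    \sum_(v <- box n) mislabel_cost l v.
  apply: h2.
  - by move=> [a b] [a' b'] [/addIr -> ->].
  - by move=> v; rewrite !inE eqxx orbT.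
  - by case=> a b; rewrite /cone !mem_box /=; lia.
have : \sum_(v <- box n) cone_weight R v * (~~ l (v.1, v.2 - 1))%:R <=
    \sum_(v <- box n) mislabel_cost l v.
  apply: h3.
  - by move=> [a b] [a' b'] [-> /addIr ->].
  - by move=> v; rewrite !inE eqxx !orbT.
  - by case=> a b; rewrite /cone !mem_box /=; lia.
have : \sum_(v <- box n) cone_weight R v * (~~ l (v.1 + 1, v.2 - 1))%:R <=
    \sum_(v <- box n) mislabel_cost l v.
  apply: h4.
  - by move=> [a b] [a' b'] [/addIr -> /addIr ->].
  - by move=> v; rewrite !inE eqxx !orbT.
  - by case=> a b; rewrite /cone !mem_box /=; lia.
lra.
Qed.

Lemma energy_ge_misaligned n st :
  2 * ln n.+1%:R * exited R n st - ln 126 - 4^-1 * \sum_(v <- box n) `|shear R v|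
  + 8^-1 * \sum_(v <- box n) cone_weight R v * (~~ aligned v st)%:R
  <= energy n (- 2^-1) st.
Proof.
have := pot_exited n st; have := misaligned_cost (labels st) n.
rewrite /energy.
have : - 4^-1 * \sum_(v <- box n) `|shear R v| +
    2^-1 * \sum_(v <- box n) mislabel_cost (labels st) v <=
    - 4^-1 * label_sum (shear R) (box n) (labels st).
  rewrite /label_sum !mulr_sumr -big_split /=; apply: ler_sum => v _.
  rewrite /mislabel_cost /sgb; case: ifP => _.
    by have := ler_norm (shear R v); lra.
  by case: (lerP 0 (shear R v)) => h; [rewrite ger0_norm //|rewrite ltr0_norm //]; lra.
rewrite /aligned; lra.
Qed.

Lemma block_running n v w : cone v -> v \in box n -> w \in block v -> ~~ halted n w.
Proof.
case: v => a b; rewrite /cone !inE mem_box /= => vc vb.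
by move=> /or4P[] /eqP -> /=; rewrite /halted mem_box xpair_eqE /=; lia.
Qed.

(** The final computation for q = 1. Here L is twice the logarithm of the radius,
    e and r are the probabilities of having left the box and of still running, S
    and B the sums of |D| and of the cone weights, lB the signed sum of the cone
    weights, W the expected weight of the misaligned blocks, and
    2080 = 8 * 130 * 2. *)
Lemma exit_arith (d L e r P S B lB W a b C : R) : d = 2080^-1 / 64 ->
    L * e + (- a - 4^-1 * S + 8^-1 * W) <= P + 4^-1 * (d * (2^-1 * L)) ->
    130^-1 * (2^-1 * (B - lB)) <= W -> 8^-1 * (2^-1 * L - b) <= B ->
    lB <= d * (2^-1 * L) -> S <= 8 * (2^-1 * L) + C -> 0 <= b -> 2 <= L ->
    r <= d -> P + a + `|C| + b <= d * (2^-1 * L) -> e + r <= 1 - d.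
Proof.
move=> ed g1 g2 g3 g4 g5 g6 g7 g8 g9.
suff : e <= 1 - 2 * d by lra.
have L0 : 0 < L by lra.
rewrite -(ler_pM2l L0).
have CC := ler_norm C; have C0 := normr_ge0 C.
by rewrite ed in g1 g4 g9 *; lra.
Qed.

(** Optional stopping as for q < 1, with the gain of [misaligned_end] added for
    each cone vertex that carries the label V at the start. These vertices have
    half of the total cone weight, up to a small error, since the labels are
    balanced. *)
Lemma hit_bound_eq1 : hit_bound 1.
Proof.
have q01 : 0 <= (1 : R) <= 1 by rewrite ler01 lexx.
(* kap / 8 is the relative gain from the cone; d leaves room for the errors. *)
pose kap : R := 2080^-1.
pose d : R := kap / 64.
exists d; first by rewrite /d /kap; apply/andP; split; lra.
have d0 : 0 < d by rewrite /d /kap; lra.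
have l8 : 0 <= ln 8 :> R by rewrite ln_ge0 //; lra.
have d2 : d <= 2^-1 by rewrite /d /kap; lra.
move=> st bal x0.
have [C hC] := sum_shear_le R.
pose K := potential R (position st) + ln 126 + `|C| + ln 8.
have [m1 hm1] := ln_unbounded (`|K| / d + 1).
have [n [mn h1 h2]] := bal d (maxn m1 (maxn (absz (position st).1) (absz (position st).2))) d0.
have xb : position st \in box n.
  by rewrite mem_box; move: mn; rewrite !geq_max => /and3P[_ -> ->].
have hl := hm1 n ltac:(lia).
have hs : ~~ halted n (position st) by rewrite /halted negb_or x0 xb.
have [k hk] := running_small d0 hs q01.
have [j ej] : exists j, j = (6 + k)%N by exists (6 + k)%N.
exists j; apply: le_trans (avoid_le_stopped q01 n _ x0) _.
have hk6 := hk j ltac:(lia).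
have {}hk := hk k (leqnn k).
have K0 := normr_ge0 K.
have l1 : 1 <= ln n.+1%:R :> R by have : 0 <= `|K| / d by [rewrite divr_ge0 // ltW]; lra.
have lK : `|K| <= d * ln n.+1%:R by rewrite mulrC -ler_pdivrMr //; lra.
have E1 : stopped (1 : R) (halted n) (energy n (- 2^-1)) j st <= energy n (- 2^-1) st.
  apply: (@stopped_super R 1 q01 (halted n) (energy n (- 2^-1)) _ j st) => s hs'.
  by apply: energy_super hs'; clear; field.
have E2 : stopped 1 (halted n) (fun s => 2 * ln n.+1%:R * exited R n s +
      ((- ln 126 - 4^-1 * \sum_(v <- box n) `|shear R v|) +
      8^-1 * \sum_(v <- box n) cone_weight R v *
        (halted n (position s) && (aligned v s == false))%:R)) j st
   <= stopped 1 (halted n) (energy n (- 2^-1)) j st.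
  apply: stopped_le => // s; apply: le_trans (energy_ge_misaligned n s).
  have : \sum_(v <- box n) cone_weight R v *
        (halted n (position s) && (aligned v s == false))%:R <=
      \sum_(v <- box n) cone_weight R v * (~~ aligned v s)%:R.
    apply: ler_sum => v _; rewrite ler_wpM2l ?cone_weight_ge0 //.
    by case: halted; case: aligned.
  have aux (x a b y z : R) : y <= z ->
      x + ((- a - b) + 8^-1 * y) <= x - a - b + 8^-1 * z by clear; lra.
  exact: aux.
move: E2; rewrite stoppedD // stoppedZ // stoppedD // stopped_cst //.
rewrite stoppedZ // stopped_sum // => E2.
have hlow : 130^-1 * \sum_(v <- box n) cone_weight R v * (~~ labels st v)%:R <=
   \sum_(v <- box n) stopped 1 (halted n) (fun s => cone_weight R v *
     (halted n (position s) && (aligned v s == false))%:R) j st.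
  rewrite mulr_sumr big_seq [leRHS]big_seq; apply: ler_sum => v vb.
  rewrite stoppedZ // mulrCA.
  rewrite [cone_weight R v]/cone_weight; case: ifP => vc; last by rewrite !mul0r.
  apply: ler_wpM2l; first by rewrite invr_ge0 mulr_ge0 // sqr_ge0.
  have hB w : w \in block v -> ~~ halted n w.
    exact: (block_running vc vb).
  have e0 := @ends_ge0 R _ _ hB false j st.
  have [lv|lv] := boolP (labels st v); first by rewrite (_ : (~~ true)%:R = 0) // mulr0.
  rewrite (_ : (~~ false)%:R = 1) // mulr1.
  have na : ~~ aligned v st by apply/allPn; exists v => //; exact: mem_head.
  have := misaligned_end R hB k na; rewrite -ej; apply: le_trans.
  have aux (x y : R) : x + y = 1 -> y <= 2^-1 -> 130^-1 <= 65^-1 * x by clear; lra.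
  apply: aux (_ : _ <= _); last exact: le_trans hk d2.
  rewrite -stoppedD // -[RHS](stopped_cst 1 (halted n) 1 k st); congr stopped.
  by apply/funext => s; rewrite /running; case: halted; rewrite /= ?addr0 ?add0r.
have hmis : \sum_(v <- box n) cone_weight R v * (~~ labels st v)%:R =
    2^-1 * (\sum_(v <- box n) cone_weight R v - label_sum (cone_weight R) (box n) (labels st)).
  rewrite /label_sum -sumrB mulr_sumr; apply: eq_bigr => v _.
  by rewrite /sgb; case: (labels _ _) => /=; lra.
have hth := sum_cone_weight_ge R n.
have hen : energy n (- 2^-1) st <= potential R (position st) + 4^-1 * (d * ln n.+1%:R).
  rewrite /energy; have := lerNnormlW h1; lra.
have h2' := le_trans (ler_norm _) h2.
rewrite hmis in hlow.
have eK : K = potential R (position st) + ln 126 + `|C| + ln 8 by [].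
have E3 := le_trans E2 (le_trans E1 hen).
have half : 2^-1 * (2 * ln n.+1%:R) = ln n.+1%:R :> R by clear; field.
apply: (exit_arith (L := 2 * ln n.+1%:R) (P := potential R (position st)) (a := ln 126)
  (S := \sum_(v <- box n) `|shear R v|) (b := ln 8) (C := C) _ _ hlow _ _ _ l8 _ hk6).
- exact: erefl.
- by rewrite half; exact: E3.
- by rewrite half; exact: hth.
- by rewrite half; exact: h2'.
- by rewrite half; exact: hC.
- by move: l1; clear; lra.
- by rewrite half -eK; apply: le_trans lK; exact: ler_norm.
Qed.

Lemma hit_bound_all (q : R) : 3^-1 < q <= 1 -> hit_bound q.
Proof.
move=> /andP[q3]; rewrite le_eqVlt => /predU1P[->|q1]; first exact: hit_bound_eq1.
by apply: hit_bound_lt1; rewrite q3.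
Qed.

(** The hitting bound applies to each of the finitely many states reachable in m
    steps, so that a factor 1 - d is gained again and again. *)
Lemma avoid_small (q : R) : 3^-1 < q <= 1 -> forall st, balanced (labels st) ->
  forall e : R, 0 < e -> exists k, avoid q k st <= e.
Proof.
move=> hq; have [d /andP[d0 d1] hd] := hit_bound_all hq.
have q01 : 0 <= q <= 1 by case/andP: hq => h1 h2; apply/andP; split; lra.
have hd' st : balanced (labels st) -> exists k, avoid q k st <= 1 - d.
  move=> bal.
  have h a b : exists k, (if position (hv_step a b st) == (0, 0) then 0
      else avoid q k (hv_step a b st)) <= 1 - d.
    case: eqP => [_|/eqP x0]; first by exists 0%N; lra.
    exact: hd (balanced_step a b bal) x0.
  have [k1 h1] := h true true; have [k2 h2] := h true false.
  have [k3 h3] := h false true; have [k4 h4] := h false false.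
  exists (maxn (maxn k1 k2) (maxn k3 k4)).+1.
  rewrite [avoid _ _ _]/= -[leRHS](step_mean_cst q (1 - d) st).
  apply: step_mean_le => // a b.
  have [k [kk hk]] : exists k, (k <= maxn (maxn k1 k2) (maxn k3 k4))%N /\
     (if position (hv_step a b st) == (0, 0) then 0 else avoid q k (hv_step a b st)) <= 1 - d.
    by case: a; case: b; [exists k1|exists k2|exists k3|exists k4]; split => //; lia.
  by apply: le_trans hk; case: ifP => // _; exact: avoid_anti.
have pw k st : balanced (labels st) -> exists n, avoid q n st <= (1 - d) ^+ k.
  elim: k st => [|k IH] st bal; first by exists 0%N; rewrite expr0.
  have [m hm] := hd' _ bal.
  suff [n hn] : exists n, avoid q n st <= (1 - d) ^+ k * avoid q m st.
    by exists n; rewrite exprSr (le_trans hn) // ler_wpM2l // exprn_ge0 //; lra.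
  elim: m st bal {hm} => [|m IHm] st bal.
    by have [n hn] := IH _ bal; exists n; rewrite mulr1.
  have h a b := IHm _ (balanced_step a b bal).
  have [k1 h1] := h true true; have [k2 h2] := h true false.
  have [k3 h3] := h false true; have [k4 h4] := h false false.
  exists (maxn (maxn k1 k2) (maxn k3 k4)).+1.
  rewrite /= -step_meanZ; apply: step_mean_le => // a b; case: ifP => _; first by rewrite mulr0.
  have [j [kk hk]] : exists j, (j <= maxn (maxn k1 k2) (maxn k3 k4))%N /\
     avoid q j (hv_step a b st) <= (1 - d) ^+ k * avoid q m (hv_step a b st).
    by case: a; case: b; [exists k1|exists k2|exists k3|exists k4]; split => //; lia.
  by apply: le_trans hk; exact: avoid_anti.
move=> st bal e e0.
(* Bernoulli's inequality bounds the powers of 1 - d. *)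
have bernoulli k : (1 + k%:R * d) * (1 - d) ^+ k <= 1.
  elim: k => [|k IH]; first by rewrite expr0 mul0r addr0 mulr1.
  apply: le_trans IH; rewrite exprS mulrA ler_wpM2r ?exprn_ge0 //; first by lra.
  by rewrite -natr1; have := ler0n R k; nra.
pose N := Num.bound (e^-1 / d).
have hN : e^-1 < N%:R * d.
  by rewrite -ltr_pdivrMr //; apply: archi_boundP; rewrite divr_ge0 ?invr_ge0 // ltW.
have [n hn] := pw N st bal; exists n; apply: le_trans hn _.
have p0 : 0 <= (1 - d) ^+ N by rewrite exprn_ge0 //; lra.
have ei0 : 0 < e^-1 by rewrite invr_gt0.
rewrite -(ler_pM2l ei0) mulVf ?gt_eqF //.
apply: le_trans (bernoulli N); rewrite ler_wpM2r //; lra.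
Qed.

End Hit.

(** * Outer measure, cylinders and typical labels *)

Section OuterMeasure.
Context (R : realType) (d : measure_display) (T : measurableType d) (P : probability T R).

(** An upper bound for the outer measure: it avoids proving measurability of the
    events of interest, only the cylinders that cover them being measured. *)
Definition outer_le (A : set T) (r : R) : Prop :=
  exists M, [/\ measurable M, A `<=` M & (P M <= r%:E)%E].

Lemma outer_leU A B r s : outer_le A r -> outer_le B s -> outer_le (A `|` B) (r + s).
Proof.
move=> [M [mM AM Mr]] [N [mN BN Ns]]; exists (M `|` N); split; first exact: measurableU.
  exact: setUSS.
apply: le_trans (measureU2 _ _ _) _ => //.
by rewrite EFinD leeD.
Qed.

Lemma outer_leS A B r : A `<=` B -> outer_le B r -> outer_le A r.
Proof. by move=> AB [M [mM BM Mr]]; exists M; split => //; exact: subset_trans BM. Qed.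

Lemma outer_le_le A r s : r <= s -> outer_le A r -> outer_le A s.
Proof.
by move=> rs [M [mM AM Mr]]; exists M; split => //; rewrite (le_trans Mr) // lee_fin.
Qed.

Lemma outer_le0 r : 0 <= r -> outer_le set0 r.
Proof. by move=> r0; exists set0; split => //; rewrite measure0 lee_fin. Qed.

Lemma outer_le_measure A r : measurable A -> P A = r%:E -> outer_le A r.
Proof. by move=> mA PA; exists A; split => //; rewrite PA. Qed.

Lemma negligible_outer A : (forall r, 0 < r -> outer_le A r) -> P.-negligible A.
Proof.
move=> h; have h' k : outer_le A (k.+1%:R^-1) by apply: h; rewrite invr_gt0.
have [M hM] : {M : nat -> set T & forall k,
    [/\ measurable (M k), A `<=` M k & (P (M k) <= (k.+1%:R^-1)%:E)%E]}.
  exists (fun k => sval (cid (h' k))) => k; exact: svalP (cid (h' k)).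
have mM : measurable (\bigcap_k M k) by apply: bigcapT_measurable => k; have [] := hM k.
exists (\bigcap_k M k); split => //; last by move=> x Ax k _; have [_ + _] := hM k; apply.
apply/eqP; rewrite eq_le measure_ge0 andbT; apply/lee_addgt0Pr => e e0.
rewrite add0e.
have [k hk] : exists k : nat, k.+1%:R^-1 <= e.
  exists (Num.bound e^-1); rewrite invf_ple ?posrE //.
  apply: le_trans (ltW (archi_boundP _)) _; first by rewrite invr_ge0 ltW.
  by rewrite ler_nat leqW.
have [mk _ lek] := hM k.
apply: le_trans (le_measure _ _ _ _) _; last 2 first.
- exact: (bigcap_inf (i := k)).
- by apply: le_trans lek _; rewrite lee_fin.
- by rewrite inE.
- by rewrite inE.
Qed.

Lemma negligible_countable (I : countType) (F : I -> set T) :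
  (forall i, P.-negligible (F i)) -> P.-negligible (\bigcup_i F i).
Proof.
move=> h; pose G n := if unpickle n is Some i then F i else set0.
apply: (negligibleS (A := \bigcup_n G n)).
  by move=> x [i _ Fx]; exists (pickle i) => //; rewrite /G pickleK.
apply: negligible_bigcup => n; rewrite /G; case: unpickle => [i|]; first exact: h.
exact: negligible_set0.
Qed.

Lemma bernoulli_false (p : R) (Y : {RV P >-> bool}) : bernoulli_rv p Y ->
  P (Y @^-1` [set false]) = (1 - p)%:E.
Proof.
move=> h; rewrite (_ : [set false] = ~` [set true]); last first.
  by apply/seteqP; split => -[] //= /(_ erefl).
by rewrite -preimage_setC probability_setC ?h //; exact: measurable_funPTI.
Qed.

Section Cylinder.
Context (I : choiceType) (X : I -> {RV P >-> bool}).
Hypothesis indep : mutually_independent X.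

Definition cylinder (s : seq I) (f : I -> bool) : set T :=
  [set w | forall i, i \in s -> X i w = f i].

Lemma cylinder_measure s f (p : I -> R) : uniq s ->
  (forall i, i \in s -> P (X i @^-1` [set f i]) = (p i)%:E) ->
  outer_le (cylinder s f) (\prod_(i <- s) p i).
Proof.
move=> us hp.
have e : cylinder s f = \bigcap_(i in [set` s]) (X i @^-1` [set f i]).
  by apply/seteqP; split => [w h i /= si|w h i si]; [exact: h|exact: (h i si)].
apply: outer_le_measure.
  rewrite e bigcap_seq; apply: bigsetI_measurable => i _; exact: measurable_funPTI.
rewrite e indep // -prodEFin big_seq [RHS]big_seq.
by apply: eq_bigr => i; exact: hp.
Qed.

End Cylinder.
End OuterMeasure.

Section Labels.
Context (R : realType) (d : measure_display) (T : measurableType d) (P : probability T R).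
Context (rho : vertex -> {RV P >-> bool}).
Hypothesis hrho : iid_uniform_labels rho.

Lemma label_prob v b : P (rho v @^-1` [set b]) = (2^-1 : R)%:E.
Proof.
have [_ h] := hrho; case: b; first exact: h.
by rewrite (bernoulli_false (h v)); congr EFin; field.
Qed.

(** Chebyshev's inequality by induction on s, revealing one label at a time: acc
    is the part of the sum already revealed on the cylinder, and
    (acc + x)^2 and (acc - x)^2 have mean acc^2 + x^2. *)
Lemma label_sum_tail_cylinder (phi : vertex -> R) (a : R) s (u : seq vertex)
    (f : labelling) (acc : R) :
  0 < a -> uniq (s ++ u) ->
  outer_le P (cylinder rho u f `&` [set w | a <= `|acc + label_sum phi s (fun v => rho v w)|])
    (2^-1 ^+ size u * ((acc ^+ 2 + \sum_(v <- s) phi v ^+ 2) / a ^+ 2)).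
Proof.
move=> a0; elim: s u f acc => [|v s IH] u f acc us.
  rewrite big_nil addr0.
  have [h|h] := lerP a `|acc|; last first.
    apply: (outer_leS (B := set0)).
      move=> w [_ /=]; rewrite /label_sum big_nil addr0 => h'.
      by move: h; rewrite ltNge h'.
    by apply: outer_le0; rewrite mulr_ge0 ?exprn_ge0 ?divr_ge0 ?sqr_ge0 // invr_ge0.
  apply: (outer_leS (B := cylinder rho u f)); first by move=> w [].
  apply: (outer_le_le (r := \prod_(i <- u) 2^-1)); last first.
    by apply: (cylinder_measure (p := fun=> 2^-1) (proj1 hrho)) => // i _; exact: label_prob.
  rewrite big_const_seq count_predT iter_mulr_1 ler_peMr ?exprn_ge0 ?invr_ge0 //.
  rewrite ler_pdivlMr ?exprn_gt0 // mul1r -[acc ^+ 2]real_normK ?num_real //.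
  by rewrite ler_sqr ?nnegrE // ltW.
have uv : uniq (s ++ v :: u).
  by move: us; rewrite -cat_rcons -cats1 -catA /= !cat_uniq /= !mem_cat has_sym /= ; lia.
have vu : v \notin u by move: us; rewrite /= mem_cat; case/andP; rewrite negb_or => /andP[].
pose g b := fun i => if i == v then b else f i.
have h b := IH (v :: u) (g b) (acc + phi v * sgb b) uv.
rewrite (_ : 2^-1 ^+ size u * _ =
   2^-1 ^+ size (v :: u) *
     (((acc + phi v * sgb true) ^+ 2 + \sum_(v <- s) phi v ^+ 2) / a ^+ 2) +
   2^-1 ^+ size (v :: u) *
     (((acc + phi v * sgb false) ^+ 2 + \sum_(v <- s) phi v ^+ 2) / a ^+ 2)); last first.
  rewrite big_cons /sgb /= [2^-1 ^+ _.+1]exprS.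
  move: (2^-1 ^+ size u) (\sum_(j <- s) _) (phi v) => p S c.

  by field; exact: lt0r_neq0.
apply: outer_leS (outer_leU (h true) (h false)) => w [wu /= wa].
have {}wa : a <= `|acc + phi v * sgb (rho v w) + label_sum phi s (fun v => rho v w)|.
  by move: wa; rewrite /label_sum big_cons addrA.
have wc : cylinder rho (v :: u) (g (rho v w)) w.
  move=> i; rewrite inE /g; case: eqP => [-> //|_ /= iu]; exact: wu.
by case: (rho v w) wa wc => wa wc; [left|right].
Qed.

Lemma label_sum_tail (phi : vertex -> R) (a : R) s : 0 < a -> uniq s ->
  outer_le P [set w | a <= `|label_sum phi s (fun v => rho v w)|]
    ((\sum_(v <- s) phi v ^+ 2) / a ^+ 2).
Proof.
move=> a0 us.
have := @label_sum_tail_cylinder phi a s [::] xpredT 0 a0; rewrite cats0 => /(_ us).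
rewrite expr0 mul1r expr0n add0r; apply: outer_leS => w /= h; split => //=.
by rewrite add0r.
Qed.

Definition shift_labels (z : vertex) (l : labelling) : labelling :=
  fun v => l (v.1 + z.1, v.2 + z.2).

Lemma shifted_label_sum_tail (phi : vertex -> R) z (a : R) s : 0 < a -> uniq s ->
  outer_le P [set w | a <= `|label_sum phi s (shift_labels z (fun v => rho v w))|]
    ((\sum_(v <- s) phi v ^+ 2) / a ^+ 2).
Proof.
move=> a0 us; pose tau (v : vertex) : vertex := (v.1 + z.1, v.2 + z.2).
pose tauV (v : vertex) : vertex := (v.1 - z.1, v.2 - z.2).
have tK : cancel tau tauV by case=> x y; rewrite /tau /tauV /= !addrK.
have um : uniq (map tau s) by rewrite (map_inj_uniq (can_inj tK)).
have := label_sum_tail (phi \o tauV) a0 um.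
rewrite big_map; under eq_bigr do rewrite /= tK.
apply: outer_leS => w; rewrite /= /label_sum big_map.
by under [X in _ -> _ <= `|X|]eq_bigr do rewrite /= tK.
Qed.

(** Since the weights are bounded, the sum of their squares over a box is
    O(ln n), which is negligible with respect to (ln n)^2. *)
Lemma ae_balanced : {ae P, forall w, forall z : vertex,
  balanced R (shift_labels z (fun v => rho v w))}.
Proof.
have [C hC] := sum_shear_le R.
pose bad (i : vertex * nat * nat) : set T := [set w | forall n : nat, (i.2 <= n)%N ->
   ~ (`|label_sum (shear R) (box n) (shift_labels i.1.1 (fun v => rho v w))|
        <= i.1.2.+1%:R^-1 * ln n.+1%:R /\
      `|label_sum (cone_weight R) (box n) (shift_labels i.1.1 (fun v => rho v w))|
        <= i.1.2.+1%:R^-1 * ln n.+1%:R)].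
apply: (negligibleS (A := \bigcup_i bad i)).
  move=> w; apply: contra_notP => nb z e m e0.
  have [k hk] : exists k : nat, k.+1%:R^-1 <= e.
    exists (Num.bound e^-1); rewrite invf_ple ?posrE //.
    apply: le_trans (ltW (archi_boundP _)) _; first by rewrite invr_ge0 ltW.
    by rewrite ler_nat leqW.
  apply: contrapT => h; apply: nb; exists (z, k, m) => // n /= mn [h1 h2]; apply: h.
  exists n; split => //.
    by apply: le_trans h1 _; rewrite ler_wpM2r // ln_ge0 // (ler_nat _ 1).
  by apply: le_trans h2 _; rewrite ler_wpM2r // ln_ge0 // (ler_nat _ 1).
apply: negligible_countable => -[[z k] m]; apply: negligible_outer => r r0.
pose e : R := k.+1%:R^-1.
have e0 : 0 < e by rewrite invr_gt0.
pose K : R := 2 * ln 126 + 1.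
have K0 : 0 < K.
  by rewrite /K ltr_wpDl // mulr_ge0 // ln_ge0 // (ler_nat _ 1).
have [m1 hm1] := ln_unbounded (2 * K * (8 + `|C|) / (e ^+ 2 * r) + 1).
pose n := maxn m m1.
have hl := hm1 n (leq_maxr _ _).
pose L : R := ln n.+1%:R.
have hL : 2 * K * (8 + `|C|) / (e ^+ 2 * r) + 1 <= L by [].
have er0 : 0 < e ^+ 2 * r by rewrite mulr_gt0 // exprn_gt0.
have C0 := normr_ge0 C.
have L1 : 1 <= L.
  apply: le_trans hL; rewrite lerDr divr_ge0 ?(ltW er0) // !mulr_ge0 ?(ltW K0) // addr_ge0 //.
have L0 : 0 < L by lra.
have eL : 0 < e * L by rewrite mulr_gt0.
have h1 := @shifted_label_sum_tail (shear R) z _ _ eL (box_uniq n).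
have h2 := @shifted_label_sum_tail (cone_weight R) z _ _ eL (box_uniq n).
have s1 : \sum_(v <- box n) shear R v ^+ 2 <= K * (8 * L + `|C|).
  apply: (@le_trans _ _ (K * \sum_(v <- box n) `|shear R v|)).
    rewrite mulr_sumr; apply: ler_sum => v _.
    rewrite -real_normK ?num_real // expr2 ler_wpM2r //.
    by have := shear_bounded R v; rewrite /K; lra.
  rewrite ler_wpM2l ?(ltW K0) //; have := hC n; have := ler_norm C; rewrite -/L; lra.
have s2 : \sum_(v <- box n) cone_weight R v ^+ 2 <= K * (8 * L + `|C|).
  apply: (@le_trans _ _ (K * \sum_(v <- box n) `|shear R v|)).
    rewrite mulr_sumr; apply: ler_sum => v _.
    rewrite expr2 ler_pM ?cone_weight_ge0 ?cone_weight_shear //.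
    have := cone_weight_le1 R v; have : 0 <= ln 126 :> R by rewrite ln_ge0 // (ler_nat _ 1).
    by rewrite /K; lra.
  rewrite ler_wpM2l ?(ltW K0) //; have := hC n; have := ler_norm C; rewrite -/L; lra.
have bound S : S <= K * (8 * L + `|C|) -> S / (e * L) ^+ 2 <= 2^-1 * r.
  move=> hS; rewrite ler_pdivrMr ?exprn_gt0 //; apply: le_trans hS _.
  have h : 2 * K * (8 + `|C|) <= L * (e ^+ 2 * r).
    by rewrite -ler_pdivrMr //; lra.
  apply: (@le_trans _ _ (K * (8 + `|C|) * L)).
    rewrite -mulrA; apply: ler_wpM2l (ltW K0) _ _ _.
    by have := ler_wpM2l C0 L1; lra.
  have := ler_wpM2r (ltW L0) h; rewrite exprMn expr2; lra.
have := outer_leU (outer_le_le (bound _ s1) h1) (outer_le_le (bound _ s2) h2).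
rewrite -mulrDl [_ + 2^-1](_ : _ = 1) ?mul1r; last by field.
apply: outer_leS => w /(_ n (leq_maxl _ _)) /= nh.
have [g1|g1] := lerP (e * L)
  `|label_sum (shear R) (box n) (shift_labels z (fun v => rho v w))|; first by left.
have [g2|g2] := lerP (e * L)
  `|label_sum (cone_weight R) (box n) (shift_labels z (fun v => rho v w))|; first by right.
by case: nh; split; exact: ltW.
Qed.

End Labels.

(** * From hitting probabilities to recurrence *)

Definition shift_state (z : vertex) (st : state) : state :=
  State ((position st).1 - z.1, (position st).2 - z.2) (shift_labels z (labels st)).

Lemma hv_step_shift a b z st : hv_step a b (shift_state z st) = shift_state z (hv_step a b st).
Proof.
case: st => [[x y] l]; case: z => i j; rewrite /hv_step /shift_state /shift_labels /= !subrK.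
congr State; first by case: ifP => _ /=; rewrite addrAC.
apply/funext => -[x' y'] /=; congr (if _ then _ else _).
by rewrite !xpair_eqE /=; congr (_ && _); rewrite eq_sym subr_eq eq_sym.
Qed.

(** The walk driven by one family of inputs: flips on the left summand, senses of
    the moves on the right one. *)
Definition walk (l : labelling) (f : nat + nat -> bool) (t : nat) : state :=
  hv_walk l (f \o inl) (f \o inr) t.

Fixpoint inputs_before (t : nat) : seq (nat + nat) :=
  if t is k.+1 then inl k :: inr k :: inputs_before k else [::].

Lemma mem_inputs_before t i :
  (i \in inputs_before t) = (match i with inl k => k | inr k => k end < t)%N.
Proof.
elim: t i => [|t IH] i; first by case: i.
rewrite /= !inE IH; case: i => k; rewrite ltnS [RHS]leq_eqVlt.
  by rewrite -[inl k == inl t]/(k == t) -[inl k == inr t]/false.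
by rewrite -[inr k == inr t]/(k == t) -[inr k == inl t]/false.
Qed.

Lemma inputs_before_uniq t : uniq (inputs_before t).
Proof. by elim: t => [//|t IH] /=; rewrite inE !mem_inputs_before /= !ltnn IH. Qed.

Lemma walk_ext l f g t : (forall i, i \in inputs_before t -> f i = g i) ->
  walk l f t = walk l g t.
Proof.
elim: t => [//|t IH] h; rewrite /walk /= -!/(walk l _ t).
have <- : walk l f t = walk l g t.
  by apply: IH => i hi; apply: h; rewrite /= !inE hi !orbT.
by rewrite !h ?mem_inputs_before.
Qed.

Section Hitting.
Context (R : realType) (q : R) (d : measure_display) (T : measurableType d)
  (P : probability T R).
Context (flip forth : nat -> {RV P >-> bool}).
Hypothesis hwalk : hv_randomness q flip forth.

Local Notation X := (walk_inputs flip forth).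

Definition input_prob (f : nat + nat -> bool) (i : nat + nat) : R :=
  if i is inl _ then if f i then q else 1 - q else 2^-1.

Definition prefix_prob f t : R := \prod_(i <- inputs_before t) input_prob f i.

Lemma input_probP f i : P (X i @^-1` [set f i]) = (input_prob f i)%:E.
Proof.
have [_ h1 h2] := hwalk; case: i => k /=; case: (f _).
- exact: h1.
- exact: bernoulli_false.
- exact: h2.
- by rewrite (bernoulli_false (h2 k)); congr EFin; field.
Qed.

Variables (l : labelling) (z : vertex).

Definition override (f : nat + nat -> bool) (t : nat) (a b : bool) : nat + nat -> bool :=
  fun i => if i == inl t then a else if i == inr t then b else f i.

Lemma override_old f t a b i : i \in inputs_before t -> override f t a b i = f i.
Proof.
rewrite mem_inputs_before /override; case: i => k.
  by case: eqP => [[->]|//]; rewrite ltnn.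
by case: eqP => // _; case: eqP => [[->]|//]; rewrite ltnn.
Qed.

Lemma walk_override f t a b : walk l (override f t a b) t.+1 = hv_step a b (walk l f t).
Proof.
have e : walk l (override f t a b) t = walk l f t.
  by apply: walk_ext => i; exact: override_old.
by rewrite /walk /= -/(walk l _ t) e /override /= !eqxx.
Qed.

Lemma prefix_prob_override f t a b :
  prefix_prob (override f t a b) t.+1 = (if a then q else 1 - q) * 2^-1 * prefix_prob f t.
Proof.
rewrite /prefix_prob /= !big_cons {1}/input_prob {1}/override eqxx.
rewrite [input_prob _ (inr t)]/= mulrA.
congr (_ * _); apply: eq_big_seq => i hi.
by case: i hi => // k hi; rewrite /input_prob override_old.
Qed.

Definition avoids (t n : nat) : set T :=
  [set w | forall j, (j < n)%N -> position (walk l (X^~ w) (t + j).+1) != z].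

(** Induction on n, splitting the cylinder according to the two inputs of the
    next step, as in the recursion that defines [avoid]. *)
Lemma avoid_outer n t f :
  outer_le P (cylinder X (inputs_before t) f `&` avoids t n)
    (prefix_prob f t * avoid q n (shift_state z (walk l f t))).
Proof.
have [ind _ _] := hwalk.
elim: n t f => [|n IH] t f.
  apply: (outer_leS (B := cylinder X (inputs_before t) f)); first by move=> w [].
  rewrite mulr1; apply: (cylinder_measure ind); first exact: inputs_before_uniq.
  by move=> i _; exact: input_probP.
pose g a b := override f t a b.
have piece a b : outer_le P (cylinder X (inputs_before t.+1) (g a b) `&` avoids t n.+1)
    (prefix_prob (g a b) t.+1 *
     (if position (hv_step a b (shift_state z (walk l f t))) == (0, 0) then 0
      else avoid q n (hv_step a b (shift_state z (walk l f t))))).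
  rewrite hv_step_shift -walk_override; case: ifPn => hz.
    rewrite mulr0; apply: (outer_leS (B := set0)); last exact: outer_le0.
    move=> w [cw /(_ 0%N isT)]; rewrite addn0 (walk_ext l cw).
    move: hz; rewrite -/(g a b); case: (walk l (g a b) t.+1) => -[x y] L /=.
    by rewrite !xpair_eqE !subr_eq0 [z]surjective_pairing xpair_eqE => ->.
  apply: outer_leS (IH t.+1 (g a b)) => w [cw aw]; split => // j jn.
  by have := aw j.+1 jn; rewrite addnS addSn.
have := outer_leU (outer_leU (piece true true) (piece true false))
  (outer_leU (piece false true) (piece false false)).
rewrite !prefix_prob_override.
have -> (x1 x2 x3 x4 p : R) : q * 2^-1 * p * x1 + q * 2^-1 * p * x2 +
  ((1 - q) * 2^-1 * p * x3 + (1 - q) * 2^-1 * p * x4)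
  = p * (q * (2^-1 * (x1 + x2)) + (1 - q) * (2^-1 * (x3 + x4))) by ring.
apply: outer_leS => w [cw aw].
have cg : cylinder X (inputs_before t.+1) (g (X (inl t) w) (X (inr t) w)) w.
  move=> i; rewrite /= !inE => /or3P[/eqP->|/eqP->|hi].
  - by rewrite /g /override eqxx.
  - by rewrite /g /override /= eqxx.
  - by rewrite /g override_old // cw.
by move: cg; case: (X (inl t) w); case: (X (inr t) w) => cg;
  [left; left|left; right|right; left|right; right].
Qed.

Hypothesis hq : 3^-1 < q <= 1.
Hypothesis bal : balanced R (shift_labels z l).

Lemma avoids_negligible t f :
  P.-negligible (cylinder X (inputs_before t) f `&` [set w | forall n, avoids t n w]).
Proof.
apply: negligible_outer => r r0.
have balt : balanced R (labels (shift_state z (walk l f t))).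
  elim: t => [//|t IH].
  have -> : shift_state z (walk l f t.+1) =
    hv_step (f (inl t)) (f (inr t)) (shift_state z (walk l f t)) by rewrite hv_step_shift.
  exact: balanced_step.
have p0 : 0 <= prefix_prob f t.
  apply: prodr_ge0 => -[] k _ /=; last by rewrite invr_ge0.
  by case/andP: hq => q3 q1; case: (f _); lra.
have [n hn] := avoid_small hq balt (e := r / (prefix_prob f t + 1))
  ltac:(by rewrite divr_gt0 // ltr_wpDl).
apply: (outer_leS (B := cylinder X (inputs_before t) f `&` avoids t n)).
  by move=> w [cw aw]; split.
apply: outer_le_le (avoid_outer n t f).
apply: le_trans (ler_wpM2l p0 hn) _.
rewrite mulrCA ler_piMr ?(ltW r0) // ler_pdivrMr ?mul1r ?lerDl // ltr_wpDl //.
Qed.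

End Hitting.

(** If some vertex z is visited finitely often, then after some time t it is
    avoided for ever. There are countably many choices of z and of the
    inputs before t, and each of them has probability 0. *)
Theorem theorem1p3 (R : realType) (q : R) (hq : 3^-1 < q <= 1)
    (d1 : measure_display) (T1 : measurableType d1) (P1 : probability T1 R)
    (rho : vertex -> {RV P1 >-> bool}) (hrho : iid_uniform_labels rho)
    (d2 : measure_display) (T2 : measurableType d2) (P2 : probability T2 R)
    (flip forth : nat -> {RV P2 >-> bool}) (hwalk : hv_randomness q flip forth) :
  {ae P1, forall w1, {ae P2, forall w2,
    visits_all_infinitely_often (fun x => rho x w1)
      (fun n => flip n w2) (fun n => forth n w2)}}.
Proof.
apply: filterS (ae_balanced hrho) => w1 bal.
pose l : labelling := fun x => rho x w1.
pose X := walk_inputs flip forth.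
pose input (u : seq (bool * bool)) (i : nat + nat) : bool :=
  match i with inl k => (nth (false, false) u k).1 | inr k => (nth (false, false) u k).2 end.
pose bad (i : vertex * seq (bool * bool)) : set T2 :=
  cylinder X (inputs_before (size i.2)) (input i.2) `&`
  [set w | forall n, avoids flip forth l i.1 (size i.2) n w].
apply: (negligibleS (A := \bigcup_i bad i)); last first.
  apply: negligible_countable => -[z u].
  exact: (avoids_negligible hwalk hq (bal z) (size u) (input u)).
move=> w2; apply: contra_notP => nb z /finite_seqP[s hs].
pose t := (\max_(k <- s) k)%N.
apply: nb; exists (z, [seq (flip k w2, forth k w2) | k <- iota 0 t]) => //.
rewrite /bad /= size_map size_iota; split.
  move=> i; rewrite mem_inputs_before /X; case: i => k kt;
  by rewrite /= (nth_map 0%N) ?size_iota // nth_iota.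
move=> n j _; apply/eqP => hz.
have : (t + j).+1 \in s.
  have : [set k | position (hv_walk (fun x => rho x w1) (fun k => flip k w2)
      (fun k => forth k w2) k) = z] (t + j).+1 by exact: hz.
  by rewrite hs.
move=> ts; have : ((t + j).+1 <= t)%N by exact: (leq_bigmax_seq (F := id) _ ts).
by rewrite ltnNge leq_addr.
Qed.
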